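(* Let $(X,\langle\cdot,\cdot\rangle)$ be a real Hilbert space, let $B:\mathfrak D(B)\to X$ be the generator of a strongly continuous semigroup on $X$, let $\zeta:[-1,0]\to L(X)$ be of bounded variation, and let $\Phi: W^{1,2}([-1,0];X)\to X$ be the bounded linear operator $\Phi f=\int_{-1}^0 d\zeta(s)\, f(s)$. Let $A$ be the operator on $\mathcal E^2:=X\times L^2([-1,0];X)$ given by $$A\begin{pmatrix} x\\ f\end{pmatrix}=\begin{pmatrix} Bx+\Phi f\\ \frac{d}{d\sigma}f\end{pmatrix},\qquad \mathfrak D(A)=\left\{\begin{pmatrix} x\\ f\end{pmatrix}\in \mathfrak D(B)\times W^{1,2}([-1,0];X): f(0)=x\right\}.$$ Let $\lambda\in\mathbb R$ be such that $B-\lambda I$ is dissipative. (i) If $\mu\in\mathbb R$ satisfies $$\mu>\lambda+\left(\bigl(|\zeta|(0)-|\zeta|(-1)\bigr)\int_{-1}^0 e^{2\lambda r}\,d|\zeta|(r)\right)^{1/2},$$ then there exists an inner product on $\mathcal E^2$, equivalent to the canonical one, with respect to which $A-\mu I$ is dissipative. (ii) If $$\lambda<-\int_{-1}^0 d|\zeta|,$$ then there exists an inner product on $\mathcal E^2$, equivalent to the canonical one, with respect to which $A$ is dissipative.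
   Context: $L(X)$ denotes the bounded linear operators on $X$ with the operator norm $\|\cdot\|$. $W^{1,2}([-1,0];X)$ is the Sobolev space of (classes of) functions in $L^2([-1,0];X)$ with weak derivative in $L^2([-1,0];X)$; its elements are identified with their continuous representatives. For $\zeta:[-1,0]\to L(X)$ of bounded variation, $|\zeta|:[-1,0]\to\mathbb R$ denotes its total variation function, $|\zeta|(t)=\sup\sum_i\|\zeta(t_{i+1})-\zeta(t_i)\|$, the supremum being over all partitions $-1=t_0<t_1<\dots<t_n=t$ of $[-1,t]$ (so $|\zeta|(-1)=0$). Integrals $\int_{-1}^0 d\zeta(s)f(s)$ and $\int_{-1}^0 h(r)\,d|\zeta|(r)$ of continuous functions are Lebesgue-Stieltjes integrals; for continuous integrands they are understood to agree with the Riemann-Stieltjes integrals over the closed interval $[-1,0]$, so jumps at the end points are included; in particular $\int_{-1}^0 d|\zeta|=|\zeta|(0)-|\zeta|(-1)$. A linear operator $A:\mathfrak D(A)\to H$ with $\mathfrak D(A)\subset H$, $H$ a Hilbert space with inner product $\langle\cdot,\cdot\rangle$, is dissipative (with respect to $\langle\cdot,\cdot\rangle$) if $\langle Ax,x\rangle\le 0$ for all $x\in\mathfrak D(A)$. The canonical inner product on $X\times L^2([-1,0];X)$ is $\langle c,d\rangle+\int_{-1}^0\langle f(s),g(s)\rangle\,ds$. Two inner products are equivalent if they induce equivalent norms. *)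

(* Defs.v *)
From HB Require Import structures.
From mathcomp Require Import all_boot all_order all_algebra.
From mathcomp Require Import generic_quotient ring_quotient sesquilinear ring.
From mathcomp Require Import all_classical all_reals all_analysis.
From mathcomp Require Import measurable_realfun.
Set Implicit Arguments.
Unset Strict Implicit.
Unset Printing Implicit Defensive.
Import Order.TTheory GRing.Theory Num.Theory.
Import numFieldNormedType.Exports.
Local Open Scope classical_set_scope.
Local Open Scope ring_scope.
Local Open Scope quotient_scope.

Definition delay_itv {R : realType} : set R := `[-1, 0]%classic.

Section operators.
Context {R : realType} {X : normedModType R}.

Definition bounded_operator (T : X -> X) : Prop :=
  linear T /\ exists M : R, forall x, `|T x| <= M * `|x|.

Definition opnorm (T : X -> X) : R := sup [set `|T x| | x in [set x | `|x| <= 1]].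

Record C0semigroup (T : R -> X -> X) : Prop := {
  C0semigroup_bounded : forall t, 0 <= t -> bounded_operator (T t) ;
  C0semigroup0 : forall x, T 0 x = x ;
  C0semigroupD : forall s t x, 0 <= s -> 0 <= t -> T (s + t) x = T s (T t x) ;
  C0semigroup_continuous : forall x, T t x @[t --> 0^'+] --> x }.

(* Unbounded operators are given by a domain and a total function whose values
   outside the domain are irrelevant. *)
Definition is_generator (T : R -> X -> X) (D : set X) (B : X -> X) : Prop :=
  let quotient x h := h^-1 *: (T h x - x) in
  D = [set x | cvg (quotient x h @[h --> 0^'+])] /\
  forall x, D x -> quotient x h @[h --> 0^'+] --> B x.

Definition generates_C0semigroup (D : set X) (B : X -> X) : Prop :=
  exists2 T, C0semigroup T & is_generator T D B.

End operators.

Section inner_products.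
Context {R : realType} {V : lmodType R}.

Definition dissipative (ip : V -> V -> R) (D : set V) (A : V -> V) : Prop :=
  forall x, D x -> ip (A x) x <= 0.

Definition ip_norm (ip : V -> V -> R) (x : V) : R := Num.sqrt (ip x x).

Definition equivalent_ip (ip1 ip2 : V -> V -> R) : Prop :=
  exists c C : R, [/\ 0 < c, 0 < C &
    forall x, c * ip_norm ip1 x <= ip_norm ip2 x <= C * ip_norm ip1 x].

End inner_products.

Section stieltjes.
Context {R : realType}.

(* [g t] is an operator from W to V; taking [W = V = R^o] and
   [g t r = h t * r] gives the integral with respect to a scalar function h.
   Subdivision points are [nth b (a :: s) i], as in [numfun.variation]. *)
Definition RS_sum (W : Type) (V : normedModType R) (g : R -> W -> V)
    (f : R -> W) (a b : R) (s : seq R) (tag : nat -> R) : V :=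
  let t := nth b (a :: s) in
  \sum_(0 <= i < size s) (g (t i.+1) (f (tag i)) - g (t i) (f (tag i))).

Definition is_RS_integral (W : Type) (V : normedModType R) (g : R -> W -> V)
    (f : R -> W) (a b : R) (v : V) : Prop :=
  forall e : R, 0 < e -> exists2 d : R, 0 < d &
    forall (s : seq R) (tag : nat -> R), itv_partition a b s ->
      let t := nth b (a :: s) in
      (forall i, (i < size s)%N ->
         t i <= tag i <= t i.+1 /\ t i.+1 - t i < d) ->
      `|RS_sum g f a b s tag - v| < e.

Definition RS_integral (W : Type) (V : normedModType R) (g : R -> W -> V)
    (f : R -> W) (a b : R) : V :=
  xget 0 [set v | is_RS_integral g f a b v].

Definition RS_integral_scalar (h f : R -> R) (a b : R) : R :=
  RS_integral (W := R) (V := R^o) (fun t r => h t * r) f a b.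

Definition op_variations (X : normedModType R) (zeta : R -> X -> X) (a b : R) :=
  [set \sum_(0 <= i < size s)
         opnorm (zeta (nth b (a :: s) i.+1) \- zeta (nth b (a :: s) i))
  | s in itv_partition a b].

Definition op_bounded_variation (X : normedModType R) (zeta : R -> X -> X)
    (a b : R) : Prop := has_ubound (op_variations zeta a b).

Definition total_var (X : normedModType R) (zeta : R -> X -> X) (t : R) : R :=
  sup (op_variations zeta (-1) t).

End stieltjes.

Section bochner.
Context {R : realType} {X : normedModType R}.
Notation mu := (@lebesgue_measure R).

(* \sum_(i < n) c_i 1_{A_i}; the sequences A and c are irrelevant from n on *)
Record simple_fun := SimpleFun {
  sf_size : nat ;
  sf_set : nat -> set R ;
  sf_val : nat -> X ;
  sf_measurable : forall i, measurable (sf_set i) }.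

Definition sf_eval (s : simple_fun) (t : R) : X :=
  \sum_(i < sf_size s) \1_(sf_set s i) t *: sf_val s i.

Definition sf_integral (s : simple_fun) : X :=
  \sum_(i < sf_size s) fine (mu (sf_set s i `&` delay_itv)) *: sf_val s i.

(* Borel sets are not completed here: every a.e. limit of simple functions
   agrees a.e. with an everywhere limit of simple functions, so the space L2
   of classes below is the usual one. *)
Definition strongly_measurable (f : R -> X) : Prop :=
  exists s : nat -> simple_fun, forall t, delay_itv t ->
    sf_eval (s n) t @[n --> \oo] --> f t.

Definition is_bochner_integral (f : R -> X) (v : X) : Prop :=
  strongly_measurable f /\
  exists s : nat -> simple_fun,
    ((\int[mu]_(t in delay_itv) `|f t - sf_eval (s n) t|%:E)%E @[n --> \oo]
       --> 0%E) /\
    sf_integral (s n) @[n --> \oo] --> v.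

Definition square_integrable (f : R -> X) : Prop :=
  strongly_measurable f /\
  (\int[mu]_(t in delay_itv) (`|f t| ^+ 2)%:E < +oo)%E.

End bochner.
Arguments simple_fun {R} X.

Section L2.
Context (R : realType) (X : normedModType R).
Notation mu := (@lebesgue_measure R).

Lemma sf_norm_measurable (s : simple_fun X) (x : X) :
  measurable_fun setT (fun t => `|x + sf_eval s t|).
Proof.
case: s => n A c mA; rewrite /sf_eval /=.
elim: n x => [|n IHn] x.
  rewrite (_ : (fun _ => _) = cst `|x|) //.
  by apply/funext => t; rewrite big_ord0 addr0.
rewrite (_ : (fun _ => _) =
  (fun t => if t \in A n then `|x + c n + \sum_(i < n) \1_(A i) t *: c i|
            else `|x + \sum_(i < n) \1_(A i) t *: c i|)); last first.
  apply/funext => t; rewrite big_ord_recr /= indicE.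
  case: ifP => _; last by rewrite scale0r addr0.
  by rewrite scale1r [X in x + X]addrC addrA.
apply: measurable_fun_ifT => //.
by apply: (measurable_fun_bool true); rewrite setTI preimage_mem_true.
Qed.

Lemma strongly_measurable_norm (f : R -> X) :
  strongly_measurable f -> measurable_fun delay_itv (fun t => `|f t|).
Proof.
move=> [s sf]; apply: (measurable_fun_cvg (h := fun n t => `|sf_eval (s n) t|)).
  move=> n; apply: measurable_funTS.
  under eq_fun => t do rewrite -[sf_eval _ _]add0r.
  exact: sf_norm_measurable.
by move=> t It; apply: cvg_norm; exact: sf.
Qed.

Lemma strongly_measurable_linear (a : R) (f g : R -> X) :
  strongly_measurable f -> strongly_measurable g ->
  strongly_measurable (fun t => a *: f t + g t).
Proof.
move=> [s sf] [r rg].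
have comb (u v : simple_fun X) : exists w : simple_fun X,
    forall t, sf_eval w t = a *: sf_eval u t + sf_eval v t.
  case: u => n A c mA; case: v => m B d mB.
  pose C i := if (i < n)%N then A i else B (i - n)%N.
  have mC i : measurable (C i) by rewrite /C; case: ifP.
  exists (SimpleFun (n + m) (fun i => if (i < n)%N then a *: c i
                                       else d (i - n)%N) mC) => t.
  rewrite /sf_eval /= big_split_ord /= scaler_sumr; congr (_ + _).
    apply: eq_bigr => i _; rewrite /C /= ltn_ord.
    by rewrite !scalerA mulrC.
  apply: eq_bigr => i _.
  by rewrite /C /= ltnNge leq_addr /= addKn.
have [w wE] := choice (fun n => comb (s n) (r n)).
exists w => t It.
under eq_fun do rewrite wE.
by apply: cvgD; [apply: cvgZr; exact: sf | exact: rg].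
Qed.

Lemma square_integrable_linear (a : R) (f g : R -> X) :
  square_integrable f -> square_integrable g ->
  square_integrable (fun t => a *: f t + g t).
Proof.
move=> [mf If] [mg Ig]; split; first exact: strongly_measurable_linear.
have msq (h : R -> X) : strongly_measurable h ->
    measurable_fun delay_itv (fun t => (`|h t| ^+ 2)%:E).
  move=> mh; apply/measurable_EFinP; apply: measurable_funX.
  exact: strongly_measurable_norm.
have mI : measurable (delay_itv : set R) by exact: measurable_itv.
pose k := 2 * a ^+ 2.
have k0 : 0 <= k by rewrite mulr_ge0// sqr_ge0.
apply: (@le_lt_trans _ _ (\int[mu]_(t in delay_itv)
    (k%:E * (`|f t| ^+ 2)%:E + 2%:E * (`|g t| ^+ 2)%:E))%E).
  apply: ge0_le_integral => //.
  - by apply: msq; exact: strongly_measurable_linear.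
  - by apply: emeasurable_funD; apply: measurable_funeM; exact: msq.
  - move=> t _; rewrite -!EFinM -EFinD lee_fin.
    have h : `|a *: f t + g t| <= `|a| * `|f t| + `|g t|.
      by rewrite -normrZ ler_normD.
    apply: (@le_trans _ _ ((`|a| * `|f t| + `|g t|) ^+ 2)).
      by rewrite ler_sqr ?nnegrE// addr_ge0// mulr_ge0.
    have ak : k = 2 * `|a| ^+ 2 by rewrite /k real_normK// num_real.
    rewrite -subr_ge0 ak [leRHS](_ : _ = (`|a| * `|f t| - `|g t|) ^+ 2).
      exact: sqr_ge0.
    by ring.
have sq0 (c : R) (h : R -> X) t : 0 <= c -> (0 <= c%:E * (`|h t| ^+ 2)%:E)%E.
  by move=> c0; rewrite -EFinM lee_fin mulr_ge0// sqr_ge0.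
have mc (c : R) (h : R -> X) : strongly_measurable h ->
    measurable_fun delay_itv (fun t => c%:E * (`|h t| ^+ 2)%:E)%E.
  by move=> mh; apply: measurable_funeM; exact: msq.
rewrite ge0_integralD//; do ?[exact: mc | by move=> t _; exact: sq0].
rewrite !ge0_integralZl_EFin//; do ?[exact: msq].
by rewrite lte_add_pinfty// lte_mul_pinfty.
Qed.

Lemma square_integrable0 : square_integrable (fun=> 0 : X).
Proof.
split.
  pose s := SimpleFun 0 (fun=> 0 : X) (fun=> measurable0).
  exists (fun=> s) => t _.
  by rewrite /sf_eval /= big_ord0; exact: cvg_cst.
by under eq_integral do rewrite normr0 expr0n /=; rewrite integral0.
Qed.

Definition L2pred : {pred R -> X} := mem [set f | square_integrable f].

Lemma L2pred_submod_closed : submod_closed L2pred.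
Proof.
split; first by rewrite inE; exact: square_integrable0.
move=> a f g /[!inE] hf hg; exact: square_integrable_linear.
Qed.

HB.instance Definition _ := GRing.isSubmodClosed.Build R (R -> X) L2pred
  L2pred_submod_closed.

Record L2fun := MkL2fun { L2fun_val :> R -> X ; _ : L2fun_val \in L2pred }.

HB.instance Definition _ := [isSub for L2fun_val].
HB.instance Definition _ := [Choice of L2fun by <:].
HB.instance Definition _ := [SubChoice_isSubLmodule of L2fun by <:].

Definition L2null : {pred L2fun} := mem [set f : L2fun | ae_eq mu delay_itv f (cst 0)].

Lemma L2null_submod_closed : submod_closed L2null.
Proof.
split; first by rewrite inE; apply: aeW => t _.
move=> a f g /[!inE]; apply: filterS2 => t ft gt It.
have f0 : f t = 0 := ft It; have g0 : g t = 0 := gt It.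
by transitivity (a *: f t + g t) => //; rewrite f0 g0 addr0 scaler0.
Qed.

HB.instance Definition _ := GRing.isSubmodClosed.Build R L2fun L2null
  L2null_submod_closed.

Definition L2 : Type := Quotient.quot (L2null : zmodClosed L2fun).
HB.instance Definition _ := GRing.Zmodule.on L2.
HB.instance Definition _ := Quotient.on L2.

Lemma pi_L2D (f g : L2fun) : \pi_L2 (f + g) = \pi_L2 f + \pi_L2 g :> L2.
Proof. exact: (@Quotient.pi_add _ (L2null : zmodClosed L2fun)). Qed.

Definition L2scale (a : R) (F : L2) : L2 := \pi_L2 (a *: repr F).

Lemma pi_L2scale (a : R) (f : L2fun) :
  L2scale a (\pi_L2 f) = \pi_L2 (a *: f).
Proof.
apply/eqP; rewrite -Quotient.idealrBE -scalerBr.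
apply: rpredZ; rewrite Quotient.idealrBE; exact/eqP/reprK.
Qed.

Lemma L2scalerA (a b : R) (F : L2) :
  L2scale a (L2scale b F) = L2scale (a * b) F.
Proof. by elim/quotW: F => f; rewrite (pi_L2scale b) !pi_L2scale scalerA. Qed.

Lemma L2scale1r : left_id 1 L2scale.
Proof. by elim/quotW => f; rewrite pi_L2scale scale1r. Qed.

Lemma L2scalerDr : right_distributive L2scale +%R.
Proof.
move=> a; elim/quotW => f; elim/quotW => g.
by rewrite !pi_L2scale -!pi_L2D pi_L2scale scalerDr.
Qed.

Lemma L2scalerDl (F : L2) : {morph L2scale^~ F : a b / a + b}.
Proof.
by elim/quotW: F => f a b; rewrite !pi_L2scale -pi_L2D scalerDl.
Qed.

HB.instance Definition _ := GRing.Zmodule_isLmodule.Build R L2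
  L2scalerA L2scale1r L2scalerDr L2scalerDl.

End L2.

Section delay.
Context {R : realType} {X : normedModType R}.
Notation mu := (@lebesgue_measure R).

(* test functions: C^1 with compact support in the open interval ]-1, 0[ *)
Definition C1_test (phi : R -> R) : Prop :=
  [/\ forall t, derivable phi t 1,
      continuous (derive1 phi) &
      exists a b : R, [/\ -1 < a, b < 0 &
        forall t, ~ (a <= t <= b) -> phi t = 0]].

Definition weak_derivative (F G : L2 X) : Prop :=
  forall phi, C1_test phi -> exists v : X,
    is_bochner_integral (fun t => derive1 phi t *: repr F t) v /\
    is_bochner_integral (fun t => phi t *: repr G t) (- v).

Definition W12 : set (L2 X) := [set F | exists G, weak_derivative F G].

Definition wderiv (F : L2 X) : L2 X := xget 0 [set G | weak_derivative F G].

Definition is_continuous_rep (F : L2 X) (f : R -> X) : Prop :=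
  {within delay_itv, continuous f} /\ ae_eq mu delay_itv (repr F) f.

(* only its values on [-1, 0], which are unique, matter *)
Definition continuous_rep (F : L2 X) : R -> X :=
  xget (cst 0) [set f | is_continuous_rep F f].

Definition delay_op (zeta : R -> X -> X) (F : L2 X) : X :=
  RS_integral zeta (continuous_rep F) (-1) 0.

Definition L2_ip (ip : X -> X -> R) (F G : L2 X) : R :=
  \int[mu]_(t in delay_itv) ip (repr F t) (repr G t).

Definition canonical_ip (ip : X -> X -> R) (u v : X * L2 X) : R :=
  ip u.1 v.1 + L2_ip ip u.2 v.2.

Definition delay_generator_domain (DB : set X) : set (X * L2 X) :=
  [set u | [/\ DB u.1, W12 u.2 &
     exists2 f, is_continuous_rep u.2 f & f 0 = u.1]].

Definition delay_generator (B : X -> X) (zeta : R -> X -> X)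
    (u : X * L2 X) : X * L2 X :=
  (B u.1 + delay_op zeta u.2, wderiv u.2).

End delay.

(* Main.v *)
(* The new inner product is [<x, y> + \int w <f, g>] with the weight
   [w r = expR (- 2 nu r) * v r], [v t = eps + k \int_{-1}^t expR (2 nu r) dV r],
   where [V] is the total variation of [zeta], so that [dw + 2 nu w dr = k dV].
   Integrating [\int w <f' - nu f, f>] by parts produces
   [v 0 |x|^2 / 2 - k / 2 \int |f|^2 dV] up to a nonpositive term, and the second
   summand absorbs [<Phi f, x> <= \int |f| |x| dV], by [2 |f| |x| <= k |f|^2 +
   |x|^2 / k].  What remains is
   [((V 0 - V (-1)) / k + v 0 - 2 (mu - lambda)) |x|^2 / 2], which is nonpositive
   for suitable [k] and [eps] as soon as
   [lambda + sqrt ((V 0 - V (-1)) \int expR (2 nu r) dV) < mu].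
   Part (i) is the case [nu = lambda], part (ii) the case [nu = mu = 0]. *)
Require Import Defs.
From HB Require Import structures.
From mathcomp Require Import all_boot all_order all_algebra sesquilinear ring lra.
From mathcomp Require Import all_classical all_reals all_analysis.
From mathcomp Require Import measurable_realfun.
Set Implicit Arguments.
Unset Strict Implicit.
Unset Printing Implicit Defensive.
Import Order.TTheory GRing.Theory Num.Theory.
Import numFieldNormedType.Exports.
Local Open Scope classical_set_scope.
Local Open Scope ring_scope.

(** * Inner products and operators *)

(** The exponential factor is an exponential shift: with [h r = expR (- nu * r) *: f r], the term
    [f' - nu f] is [h'] up to a weight, so that only the monotone [v] remains to be handled when
    integrating by parts. The obstacle is regularity: [v] may jump, [f'] is merely square
    integrable, and convergence of the Stieltjes sums of [Phi f] is not taken for granted. The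
    integrals of [f] and of [|f|^2] against [zeta] and [V] are therefore never manipulated as such.
    They are replaced by sums over uniform partitions with left tags, the same partitions for
    [Phi f] and for the Abel summation of [v] against [|h|^2]. Only exponentials are integrated
    against [V], by an explicit formula. Vector-valued integrals enter only through their pairing
    with a fixed vector, as integrals of real functions. Part (ii) does not use [nu = lambda]: for
    [lambda < 0] the factor [expR (2 * lambda * r)] exceeds 1 for negative [r], and the resulting
    bound would be worse than the one with [nu = 0]. *)

Section dot_product.
Context {R : realType} {X : normedModType R} (ip : {dot X for idfun}).

Lemma ip_sym x y : ip x y = ip y x.
Proof. by rewrite hermitian_subproof expr0 mul1r. Qed.

Lemma ipDr x y z : ip x (y + z) = ip x y + ip x z. Proof. exact: linearDr. Qed.
Lemma ipBr x y z : ip x (y - z) = ip x y - ip x z. Proof. exact: linearBr. Qed.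
Lemma ipZr a x y : ip x (a *: y) = a * ip x y. Proof. exact: linearZr_LR. Qed.
Lemma ipDl x y z : ip (x + y) z = ip x z + ip y z.
Proof. by rewrite ip_sym ipDr !(ip_sym z). Qed.
Lemma ipBl x y z : ip (x - y) z = ip x z - ip y z.
Proof. by rewrite ip_sym ipBr !(ip_sym z). Qed.
Lemma ipZl a x y : ip (a *: x) y = a * ip x y.
Proof. by rewrite ip_sym ipZr ip_sym. Qed.
Lemma ipNr x y : ip x (- y) = - ip x y. Proof. exact: linearNr. Qed.
Lemma ipNl x y : ip (- x) y = - ip x y.
Proof. by rewrite ip_sym ipNr ip_sym. Qed.
Definition ip_linE := (ipDl, ipDr, ipNl, ipNr, ipZl, ipZr).
Lemma ip_suml I (r : seq I) (P : pred I) F y :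
  ip (\sum_(i <- r | P i) F i) y = \sum_(i <- r | P i) ip (F i) y.
Proof. by rewrite ip_sym linear_sumr; apply: eq_bigr => i _; rewrite ip_sym. Qed.

Lemma ip_ge0 x : 0 <= ip x x.
Proof.
have [->|x0] := eqVneq x 0; first by rewrite linear0r.
exact/ltW/neq0_dnorm_gt0.
Qed.

Context (normE : forall x, `|x| = ip_norm ip x).

Lemma ip_sqr x : ip x x = `|x| ^+ 2.
Proof. by rewrite normE sqr_sqrtr// ip_ge0. Qed.

(** Polarization reduces the measurability of a pairing of two functions to that of norms. *)
Lemma ip_polar x y : ip x y = (`|x + y| ^+ 2 - `|x - y| ^+ 2) / 4.
Proof.
by rewrite -!ip_sqr !ip_linE (ip_sym y x); field.
Qed.

Lemma cauchy_schwarz x y : `|ip x y| <= `|x| * `|y|.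
Proof.
have [->|y0] := eqVneq y 0; first by rewrite linear0r !normr0 mulr0.
have ny : 0 < `|y| by rewrite normr_gt0.
rewrite -(@ler_pXn2r _ 2) ?nnegrE ?mulr_ge0//.
(* This vector is [|y|^2] times the component of [x] orthogonal to [y], which avoids a division. *)
have := ip_ge0 (`|y| ^+ 2 *: x - ip x y *: y).
rewrite !ip_linE (ip_sym y x) !ip_sqr => h.
have : 0 <= `|y| ^+ 2 * (`|x| ^+ 2 * `|y| ^+ 2 - ip x y ^+ 2) by nra.
by rewrite pmulr_rge0 ?exprn_gt0// subr_ge0 exprMn real_normK ?num_real.
Qed.

End dot_product.

Section operators.
Context {R : realType} {X : normedModType R}.
Implicit Types S T : X -> X.

Lemma bounded_operatorB {S T} : bounded_operator S -> bounded_operator T ->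
  bounded_operator (S \- T).
Proof.
move=> [linS [M SM]] [linT [N TN]]; split.
  move=> a x y /=; rewrite linS linT scalerBr.
  by rewrite opprD addrACA.
exists (M + N) => x /=; rewrite mulrDl (le_trans (ler_normB _ _))//.
exact: lerD.
Qed.

Lemma opnorm_has_sup {T} : bounded_operator T ->
  has_sup [set `|T x| | x in [set x | `|x| <= 1]].
Proof.
move=> [linT [M TM]]; split.
  by exists `|T 0|, 0 => //=; rewrite normr0.
exists `|M| => _ [x /= x1 <-]; rewrite (le_trans (TM x))//.
by rewrite (le_trans (ler_norm _))// normrM normr_id ler_piMr.
Qed.

Lemma opnorm_ge0 T : 0 <= opnorm T.
Proof.
(* For a set that has no supremum, [sup] is 0 by default. *)
have [hs|/sup_out] := pselect (has_sup [set `|T x| | x in [set x | `|x| <= 1]]);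
  last by rewrite /opnorm => ->.
apply: le_trans (sup_ubound hs.2 _) => /=; last first.
  by exists 0 => //=; rewrite normr0.
exact: normr_ge0.
Qed.

Lemma ler_opnorm T x : bounded_operator T -> `|T x| <= opnorm T * `|x|.
Proof.
move=> bT; have [linT _] := bT.
have T0 : T 0 = 0.
  by have := linT (-1) 0 0; rewrite scaler0 addr0 scaleN1r addNr.
have TZ a y : T (a *: y) = a *: T y.
  by have := linT a y 0; rewrite addr0 T0 addr0.
have [->|x0] := eqVneq x 0; first by rewrite T0 !normr0 mulr0.
have nx : 0 < `|x| by rewrite normr_gt0.
rewrite -ler_pdivrMr//.
have -> : `|T x| / `|x| = `|T (`|x|^-1 *: x)|.
  by rewrite TZ normrZ normfV normr_id mulrC.
apply: sup_ubound; first exact: (opnorm_has_sup bT).2.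
exists (`|x|^-1 *: x) => //=.
by rewrite normrZ normfV normr_id mulVf// gt_eqF.
Qed.

End operators.

(** * Total variation and Stieltjes sums *)

Section total_variation.
Context {R : realType} {X : normedModType R} (zeta : R -> X -> X).
Context (zeta_BV : op_bounded_variation zeta (-1) 0).
Notation V := (total_var zeta).

Lemma op_variations_rcons a b c w : b < c -> op_variations zeta a b w ->
  op_variations zeta a c (w + opnorm (zeta c \- zeta b)).
Proof.
move=> bc [s [sa sb] <-]; exists (rcons s c).
  by split; [rewrite rcons_path sa (eqP sb)|rewrite last_rcons].
(* The default of [nth] changes from [b] to [c]; it is not read inside the list, and the new last
   node is [c] itself. *)
have E j : (j <= size s)%N -> nth c (a :: rcons s c) j = nth b (a :: s) j.
  move=> js; rewrite -rcons_cons nth_rcons /= ltnS js.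
  exact: set_nth_default.
rewrite size_rcons big_nat_recr//; congr (_ + _).
  by rewrite !big_nat; apply: eq_bigr => i /andP[_ i_s]; rewrite !E// ltnW.
rewrite (E (size s))// -last_nth (eqP sb).
by rewrite -rcons_cons nth_rcons ltnn eqxx.
Qed.

Lemma op_variations_bounded t : t <= 0 -> has_ubound (op_variations zeta (-1) t).
Proof.
rewrite le_eqVlt => /orP[/eqP->//|t0]; have [M VM] := zeta_BV.
exists M => w /(op_variations_rcons t0) /VM; apply: le_trans.
by rewrite lerDl opnorm_ge0.
Qed.

Lemma op_variations_nonempty t : -1 <= t -> op_variations zeta (-1) t !=set0.
Proof.
rewrite le_eqVlt => /orP[/eqP<-|t1]; first by exists 0, [::]; rewrite ?big_nil.
by eexists; exists [:: t] => //; exact: itv_partition1.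
Qed.

(** Every partition of [[-1, s]] can be prolonged by the node [t]. This superadditivity bounds the
    increments of [zeta] by those of its variation. *)
Lemma total_var_opnorm s t : -1 <= s -> s < t -> t <= 0 ->
  V s + opnorm (zeta t \- zeta s) <= V t.
Proof.
move=> s1 st t0; rewrite -lerBrDr; apply: ge_sup.
  exact: op_variations_nonempty.
move=> w /(op_variations_rcons st) wv; rewrite lerBrDr.
by apply: sup_ubound => //; exact: op_variations_bounded.
Qed.

Lemma total_var_nondecreasing s t : -1 <= s -> s <= t -> t <= 0 -> V s <= V t.
Proof.
move=> s1; rewrite le_eqVlt => /orP[/eqP->//|st] t0.
by apply: le_trans (total_var_opnorm s1 st t0); rewrite lerDl opnorm_ge0.
Qed.

End total_variation.

(** * Uniform partitions of [-1, 0] *)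

Section uniform_partition.
Context {R : realType}.

Definition upt n i : R := -1 + i%:R / n.+1%:R.

Lemma upt0 n : upt n 0 = -1. Proof. by rewrite /upt mul0r addr0. Qed.
Lemma uptS n : upt n n.+1 = 0.
Proof. by rewrite /upt divff ?pnatr_eq0// addNr. Qed.
Lemma upt_step n i : upt n i.+1 - upt n i = n.+1%:R^-1.
Proof. by rewrite /upt -(natr1 i); field. Qed.
Lemma upt_lt n i : upt n i < upt n i.+1.
Proof. by rewrite -subr_gt0 upt_step invr_gt0 ltr0n. Qed.
Lemma upt_ge n i : -1 <= upt n i. Proof. by rewrite /upt lerDl divr_ge0. Qed.
Lemma upt_le n i : (i <= n.+1)%N -> upt n i <= 0.
Proof.
by move=> i_n; rewrite /upt addrC subr_le0 ler_pdivrMr ?ltr0n// mul1r ler_nat.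
Qed.

Definition upart n := [seq upt n i.+1 | i <- iota 0 n.+1].

Lemma nth_upart n i : (i <= n.+1)%N -> nth 0 (-1 :: upart n) i = upt n i.
Proof.
case: i => [|i] i_n /=; first by rewrite upt0.
by rewrite (nth_map 0%N) ?size_iota// nth_iota// add0n.
Qed.

Lemma upart_partition n : itv_partition (-1) 0 (upart n).
Proof.
split; last by rewrite (last_nth 0) size_map size_iota nth_upart// uptS.
apply/(pathP 0) => i; rewrite size_map size_iota => i_n.
have := nth_upart i_n; rewrite /= => ->.
by rewrite nth_upart ?upt_lt// ltnW.
Qed.

(** Restricts the limit over all tagged partitions to one sequence, which makes limits unique and
    comparable. Tags are left end points, as in the sums produced later by Abel summation. *)
Lemma RS_integral_uniform (W : Type) (U : normedModType R) (g : R -> W -> U)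
    (f : R -> W) v : is_RS_integral g f (-1) 0 v ->
  \sum_(0 <= i < n.+1) (g (upt n i.+1) (f (upt n i)) - g (upt n i) (f (upt n i)))
    @[n --> \oo] --> v.
Proof.
move=> gfv; apply/cvgrPdist_lt => e e0; have [d d0 dP] := gfv e e0.
near=> n; rewrite distrC.
have -> : \sum_(0 <= i < n.+1) (g (upt n i.+1) (f (upt n i)) -
    g (upt n i) (f (upt n i))) = RS_sum g f (-1) 0 (upart n) (upt n).
  rewrite /RS_sum size_map size_iota !big_nat; apply: eq_bigr => i /andP[_ i_n].
  by rewrite !nth_upart// ltnW.
apply: dP; first exact: upart_partition.
move=> /= i; rewrite size_map size_iota => i_n.
have /= -> := nth_upart i_n; rewrite nth_upart ?(ltnW i_n)//.
rewrite lexx (ltW (upt_lt n i)); split => //.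
rewrite upt_step; near: n.
exact: near_infty_natSinv_lt (PosNum d0).
Unshelve. all: by end_near. Qed.

End uniform_partition.

(** * Integrals over segments *)

Section segment_integral.
Context {R : realType}.
Notation mu := (@lebesgue_measure R).
Implicit Types (f g F : R -> R) (a b c s t M : R).

Lemma integrable_mull (D : set (measurableTypeR R)) c f : measurable D ->
  mu.-integrable D (EFin \o f) -> mu.-integrable D (EFin \o (fun x => c * f x)).
Proof. by move=> mD fi; apply: eq_integrable (integrableZl mD c fi). Qed.

Lemma integrable_sub (D : set (measurableTypeR R)) f g : measurable D ->
  mu.-integrable D (EFin \o f) -> mu.-integrable D (EFin \o g) ->
  mu.-integrable D (EFin \o (fun x => f x - g x)).
Proof. by move=> mD fi gi; apply: eq_integrable (integrableB mD fi gi). Qed.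

Lemma integrable_add (D : set (measurableTypeR R)) f g : measurable D ->
  mu.-integrable D (EFin \o f) -> mu.-integrable D (EFin \o g) ->
  mu.-integrable D (EFin \o (fun x => f x + g x)).
Proof. by move=> mD fi gi; apply: eq_integrable (integrableD mD fi gi). Qed.

Lemma le_normr_Rintegral_ae (D : set (measurableTypeR R)) f g : measurable D ->
  mu.-integrable D (EFin \o f) -> mu.-integrable D (EFin \o g) ->
  (forall x, D x -> 0 <= g x) ->
  {ae mu, forall x, D x -> `|f x| <= g x} ->
  `|\int[mu]_(x in D) f x| <= \int[mu]_(x in D) g x.
Proof.
move=> mD fi gi g0 fg; apply: le_trans (le_normr_Rintegral mD fi) _.
have nfi := integrable_norm fi.
rewrite /Rintegral fine_le ?integrable_fin_num//.
apply: ae_ge0_le_integral => //.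
- exact: measurable_int nfi.
- exact: measurable_int gi.
Qed.

Lemma eq_Rintegral_ae (D : set (measurableTypeR R)) f g : measurable D ->
  measurable_fun D f -> measurable_fun D g ->
  {ae mu, forall x, D x -> f x = g x} ->
  \int[mu]_(x in D) f x = \int[mu]_(x in D) g x.
Proof.
move=> mD mf mg fg; rewrite /Rintegral; congr fine; apply: ae_eq_integral => //.
- exact/measurable_EFinP.
- exact/measurable_EFinP.
- by move: fg; apply: filterS => x fgx /fgx ->.
Qed.

Lemma mu_segment s t : s <= t -> fine (mu `[s, t]) = t - s.
Proof.
rewrite le_eqVlt => /orP[/eqP->|st].
  by rewrite set_itv1 lebesgue_measure_set1 subrr.
by rewrite lebesgue_measure_itv/= lte_fin st.
Qed.

Lemma mu_segment_fin s t : (mu `[s, t] < +oo)%E.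
Proof. by rewrite lebesgue_measure_itv/=; case: ifPn => //; rewrite -EFinB ltry. Qed.

Lemma segment_bounded_integrable s t f M : measurable_fun `[s, t] f ->
  (forall x, x \in `[s, t] -> `|f x| <= M) ->
  mu.-integrable `[s, t] (EFin \o f).
Proof.
move=> mf fM; apply: measurable_bounded_integrable => //.
  exact: mu_segment_fin.
exists M; split; first exact: num_real.
by move=> N MN x /= xst; rewrite (le_trans (fM x xst))// ltW.
Qed.

Lemma segment_integrableS a b s t f : a <= s -> t <= b ->
  mu.-integrable `[a, b] (EFin \o f) -> mu.-integrable `[s, t] (EFin \o f).
Proof.
move=> as_ tb; apply: integrableS => // x /=; rewrite !in_itv/=.
by move=> /andP[sx xt]; rewrite (le_trans as_)// (le_trans xt).
Qed.

Lemma Rintegral_split a b c f : a <= b -> b <= c ->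
  mu.-integrable `[a, c] (EFin \o f) ->
  \int[mu]_(x in `[a, c]) f x =
  \int[mu]_(x in `[a, b]) f x + \int[mu]_(x in `[b, c]) f x.
Proof.
move=> ab bc fi; apply/eqP; rewrite addrC -subr_eq Rintegral_itvB//.
rewrite Rintegral_itv_obnd_cbnd//; apply: integrableS fi => //.
apply: subset_itvr; by rewrite bnd_simp.
Qed.

Lemma le_normr_Rintegral_segment s t f M : s <= t ->
  mu.-integrable `[s, t] (EFin \o f) ->
  (forall x, x \in `[s, t] -> `|f x| <= M) ->
  `|\int[mu]_(x in `[s, t]) f x| <= M * (t - s).
Proof.
move=> st fi fM; apply: le_trans (le_normr_Rintegral _ fi) _ => //.
rewrite -mu_segment// -Rintegral_cst//; apply: le_Rintegral => //.
  exact: integrable_norm.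
apply: (@segment_bounded_integrable _ _ _ `|M|) => //.
Qed.

Lemma Rintegral_FTC F f s t : s <= t -> (forall x : R, is_derive x 1 F (f x)) ->
  continuous f -> \int[mu]_(x in `[s, t]) f x = F t - F s.
Proof.
rewrite le_eqVlt => /orP[/eqP-> _ _|st dF cf].
  by rewrite set_itv1 Rintegral_set1 subrr.
have cF : continuous F.
  move=> x; apply: differentiable_continuous; apply/derivable1_diffP.
  exact: ex_derive.
rewrite /Rintegral (@continuous_FTC2 _ f F)//.
- exact: continuous_subspaceT.
- split.
  + by move=> x _; exact: ex_derive.
  + exact/cvg_at_right_filter/cF.
  + exact/cvg_at_left_filter/cF.
- by move=> x _; rewrite derive1E; exact: derive_val.
Qed.

End segment_integral.

Section exp_weight.
Context {R : realType}.
Implicit Types (nu x : R).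

Lemma is_derive_expRM nu x :
  is_derive x 1 (fun x => expR (nu * x)) (nu * expR (nu * x)).
Proof.
have dl : is_derive x 1 (fun x => nu * x) nu.
  by apply: is_derive_eq; exact: mulr1.
have := is_derive1_comp (is_derive_expR (nu * x)) dl.
by rewrite mulrC.
Qed.

Lemma continuous_expRM nu : continuous (fun x : R => expR (nu * x)).
Proof.
move=> x; apply: (@continuous_comp _ _ _ (fun x => nu * x) expR).
  exact: mulrl_continuous.
exact: continuous_expR.
Qed.

Lemma expRM_le nu x : -1 <= x <= 0 -> expR (nu * x) <= expR `|nu|.
Proof.
move=> /andP[x1 x0]; rewrite ler_expR (le_trans (ler_norm _))// normrM.
by rewrite ler_piMr// ler_norml x1 (le_trans x0).
Qed.

End exp_weight.

(** * Stieltjes integrals of exponentials *)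

Section exp_stieltjes.
Context {R : realType} (V : R -> R).
Implicit Types nu r s t p c : R.
Context (V_nd : forall s t : R, -1 <= s -> s <= t -> t <= 0 -> V s <= V t).
Notation mu := (@lebesgue_measure R).

(** [V] frozen at its end values outside [[-1, 0]]: being monotone on the whole line, it is
    measurable. *)
Let W (r : R) := V (Num.max (-1) (Num.min r 0)).

Let W_E r : -1 <= r -> r <= 0 -> W r = V r.
Proof. by move=> r1 r0; rewrite /W (min_idPl r0) (max_idPr r1). Qed.

Let W_nd : nondecreasing_fun W.
Proof.
move=> s t st; apply: V_nd.
- by rewrite le_max lexx.
- rewrite ge_max le_max lexx/= le_max; apply/orP; right.
  by rewrite le_min !ge_min st lexx orbT.
- by rewrite ge_max ge_min lexx orbT andbT lerN10.
Qed.

Let dexp (nu r : R) := nu * expR (nu * r).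

Let continuous_dexp nu : continuous (dexp nu).
Proof.
by move=> x; apply: cvgM; [exact: cvg_cst|exact: continuous_expRM].
Qed.

Let measurable_dexp nu : measurable_fun setT (dexp nu).
Proof. by apply: continuous_measurable_fun; exact: continuous_dexp. Qed.

Let dexp_le nu r : -1 <= r <= 0 -> `|dexp nu r| <= `|nu| * expR `|nu|.
Proof.
by move=> /expRM_le h; rewrite normrM (ger0_norm (expR_ge0 _)) ler_wpM2l.
Qed.

Let dexpW_integrable nu s t : -1 <= s -> t <= 0 ->
  mu.-integrable `[s, t] (EFin \o (fun r => dexp nu r * W r)).
Proof.
move=> s1 t0.
apply: (@segment_bounded_integrable _ _ _ _
    (`|nu| * expR `|nu| * (`|W (-1)| + `|W 0|))).
  apply: measurable_funM; first by apply: measurable_funTS; exact: measurable_dexp.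
  exact: nondecreasing_measurable.
move=> x; rewrite in_itv/= => /andP[sx xt].
rewrite normrM ler_pM//.
  by rewrite dexp_le// (le_trans s1 sx) (le_trans xt t0).
have h1 := W_nd (le_trans s1 sx); have h2 := W_nd (le_trans xt t0).
have h3 := ler_norm (W 0); have h4 := ler_norm (- W (-1)); rewrite normrN in h4.
have h5 := normr_ge0 (W 0); have h6 := normr_ge0 (W (-1)).
by rewrite ler_norml; apply/andP; split; lra.
Qed.

Let dexp_integrable nu s t : -1 <= s -> t <= 0 ->
  mu.-integrable `[s, t] (EFin \o dexp nu).
Proof.
move=> s1 t0.
apply: (@segment_bounded_integrable _ _ _ _ (`|nu| * expR `|nu|)).
  by apply: measurable_funTS; exact: measurable_dexp.
move=> x; rewrite in_itv/= => /andP[sx xt].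
by rewrite dexp_le// (le_trans s1 sx) (le_trans xt t0).
Qed.

(* [\int_{-1}^t expR (nu * r) dV(r)], integrated by parts. *)
Definition exp_stieltjes (nu t : R) : R :=
  expR (nu * t) * V t - \int[mu]_(r in `[-1, t]) (dexp nu r * W r).

(** A Stieltjes increment does not change when a constant [c] is subtracted from the integrator.
    With [c] the value of [V] at an end point, one boundary term vanishes and the other factors are
    bounded by [V t - V s]. *)
Let exp_stieltjesB nu s t c : -1 <= s -> s <= t -> t <= 0 ->
  exp_stieltjes nu t - exp_stieltjes nu s =
  expR (nu * t) * (V t - c) - expR (nu * s) * (V s - c)
  - \int[mu]_(r in `[s, t]) (dexp nu r * (W r - c)).
Proof.
move=> s1 st t0; rewrite /exp_stieltjes.
rewrite (Rintegral_split s1 st); last exact: dexpW_integrable.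
have -> : \int[mu]_(r in `[s, t]) (dexp nu r * (W r - c)) =
    \int[mu]_(r in `[s, t]) (dexp nu r * W r) - (expR (nu * t) - expR (nu * s)) * c.
  have <- := Rintegral_FTC st (is_derive_expRM nu) (@continuous_dexp nu).
  have di := @dexp_integrable nu s t s1 t0.
  rewrite -RintegralZr// -RintegralB//; last 2 first.
  - exact: dexpW_integrable.
  - apply: eq_integrable (integrable_mull c _ di) => // x _ /=.
    by rewrite mulrC.
  by apply: eq_Rintegral => x _; rewrite mulrBr.
ring.
Qed.

Let dexpWc_integrable nu s t c : -1 <= s -> t <= 0 ->
  mu.-integrable `[s, t] (EFin \o (fun r => dexp nu r * (W r - c))).
Proof.
move=> s1 t0.
apply: eq_integrable (integrable_sub _ (dexpW_integrable nu s1 t0)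
  (integrable_mull c _ (dexp_integrable nu s1 t0))) => // x _ /=.
by rewrite mulrBr (mulrC c).
Qed.

(** The constant subtracted from [V] depends on the sign of [nu]: with [V t] for [nu >= 0] and [V s]
    for [nu <= 0], the boundary term and the integral are both nonnegative. *)
Lemma exp_stieltjes_nondecreasing nu s t : -1 <= s -> s <= t -> t <= 0 ->
  exp_stieltjes nu s <= exp_stieltjes nu t.
Proof.
move=> s1 st t0; have V_st := V_nd s1 st t0; rewrite -subr_ge0.
have [nu0|/ltW nu0] := leP 0 nu.
- rewrite (@exp_stieltjesB _ _ _ (V t))// subrr mulr0 sub0r -mulrN opprB.
  rewrite addr_ge0 ?mulr_ge0 ?expR_ge0 ?subr_ge0//.
  rewrite -mulN1r -RintegralZl//; last exact: dexpWc_integrable.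
  apply: Rintegral_ge0 => x; rewrite /= in_itv/= => /andP[sx xt].
  rewrite mulN1r -mulrN opprB !mulr_ge0 ?expR_ge0 ?subr_ge0//.
  by rewrite -(W_E (le_trans s1 st) t0) W_nd.
- rewrite (@exp_stieltjesB _ _ _ (V s))// subrr mulr0 subr0.
  rewrite addr_ge0 ?mulr_ge0 ?expR_ge0 ?subr_ge0//.
  rewrite -mulN1r -RintegralZl//; last exact: dexpWc_integrable.
  apply: Rintegral_ge0 => x; rewrite /= in_itv/= => /andP[sx xt].
  rewrite mulN1r -mulNr /dexp -mulNr !mulr_ge0 ?expR_ge0 ?oppr_ge0 ?subr_ge0//.
  by rewrite -(W_E s1 (le_trans st t0)) W_nd.
Qed.

(** The error is the product of the length and the increment of [V], so that over a partition the
    errors add up to at most the mesh times the total increment. One half of the factor 2 pays for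
    moving the exponential from [t] to [p], the other for the remaining integral. *)
Lemma exp_stieltjes_local nu s p t : -1 <= s -> s <= p -> p <= t -> t <= 0 ->
  `|exp_stieltjes nu t - exp_stieltjes nu s - expR (nu * p) * (V t - V s)| <=
  2 * (`|nu| * expR `|nu|) * (t - s) * (V t - V s).
Proof.
move=> s1 sp pt t0; have st := le_trans sp pt; have V_st := V_nd s1 st t0.
rewrite (@exp_stieltjesB _ _ _ (V s))// subrr mulr0 subr0.
have -> : expR (nu * t) * (V t - V s) -
    \int[mu]_(r in `[s, t]) (dexp nu r * (W r - V s)) -
    expR (nu * p) * (V t - V s) =
    (expR (nu * t) - expR (nu * p)) * (V t - V s) -
    \int[mu]_(r in `[s, t]) (dexp nu r * (W r - V s)) by ring.
set K := `|nu| * expR `|nu|.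
have K0 : 0 <= K by rewrite mulr_ge0 ?expR_ge0.
rewrite (le_trans (ler_normB _ _))//.
have -> : 2 * K * (t - s) * (V t - V s) =
  K * (t - s) * (V t - V s) + K * (V t - V s) * (t - s) by ring.
apply: lerD.
  rewrite normrM (ger0_norm (x := V t - V s)) ?subr_ge0// ler_wpM2r ?subr_ge0//.
  have <- := Rintegral_FTC pt (is_derive_expRM nu) (@continuous_dexp nu).
  apply: (@le_trans _ _ (K * (t - p))); last by rewrite ler_wpM2l// lerD2l lerN2.
  apply: le_normr_Rintegral_segment => //.
    exact: dexp_integrable (le_trans s1 sp) t0.
  move=> x; rewrite in_itv/= => /andP[px xt]; apply: dexp_le.
  by rewrite (le_trans s1 (le_trans sp px)) (le_trans xt t0).
apply: le_normr_Rintegral_segment => //; first exact: dexpWc_integrable.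
move=> x; rewrite in_itv/= => /andP[sx xt].
have x1 := le_trans s1 sx; have x0 := le_trans xt t0.
rewrite normrM ler_pM//; first by apply: dexp_le; rewrite x1 x0.
by rewrite W_E// ger0_norm ?subr_ge0 ?V_nd// lerD2r V_nd.
Qed.

(** Summing the local errors gives at most [K * d * (V 0 - V (-1))]; the [+ 1] in the choice of [d]
    keeps the divisor positive. The value is a difference because [exp_stieltjes nu (-1)] is the
    boundary term [expR (- nu) * V (-1)], not 0. *)
Lemma is_RS_integral_exp nu :
  is_RS_integral (W := R) (V := R^o) (fun t r => V t * r)
    (fun r => expR (nu * r)) (-1) 0 (exp_stieltjes nu 0 - exp_stieltjes nu (-1)).
Proof.
move=> e e0; set K := 2 * (`|nu| * expR `|nu|).
have K0 : 0 <= K by rewrite !mulr_ge0 ?expR_ge0.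
have V0 : 0 <= V 0 - V (-1) by rewrite subr_ge0 V_nd// lerN10.
have KV : 0 < K * (V 0 - V (-1)) + 1 by rewrite ltr_wpDl// mulr_ge0.
exists (e / (K * (V 0 - V (-1)) + 1)); first by rewrite divr_gt0.
set d := e / _ => s tag ps /= tagP; rewrite /RS_sum /=.
set t := nth 0 (-1 :: s).
have {}tagP i : (i < size s)%N -> t i <= tag i <= t i.+1 /\ t i.+1 - t i < d.
  exact: tagP.
have t0 : t 0%N = -1 by [].
have tn : t (size s) = 0 by exact: itv_partition_nth_size.
have t1 i : (i < (size s).+1)%N -> -1 <= t i by move=> i_s; exact: itv_partition_nth_ge.
have t2 i : (i < (size s).+1)%N -> t i <= 0 by move=> i_s; exact: itv_partition_nth_le.
have telV : \sum_(0 <= i < size s) (V (t i.+1) - V (t i)) = V 0 - V (-1).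
  by rewrite (telescope_sumr (fun i => V (t i)))// tn t0.
have telE : \sum_(0 <= i < size s)
    (exp_stieltjes nu (t i.+1) - exp_stieltjes nu (t i)) =
    exp_stieltjes nu 0 - exp_stieltjes nu (-1).
  by rewrite (telescope_sumr (fun i => exp_stieltjes nu (t i)))// tn t0.
rewrite -telE -sumrB; apply: le_lt_trans (ler_norm_sum _ _ _) _.
apply: (@le_lt_trans _ _ (\sum_(0 <= i < size s) K * d * (V (t i.+1) - V (t i)))).
  rewrite !big_nat; apply: ler_sum => i /andP[_ i_s].
  have [/andP[tag1 tag2] td] := tagP i i_s.
  rewrite -mulrBl (mulrC _ (expR _)) distrC.
  apply: le_trans (exp_stieltjes_local nu (t1 i _) tag1 tag2 (t2 i.+1 _)) _ => //.
    exact: ltnW.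
  apply: ler_wpM2r; first by rewrite subr_ge0; apply: V_nd;
    [exact/t1/ltnW|exact: le_trans tag1 tag2|exact: t2].
  by rewrite ler_wpM2l// ltW.
rewrite -mulr_sumr telV.
have -> : K * d * (V 0 - V (-1)) = e * (K * (V 0 - V (-1)) / (K * (V 0 - V (-1)) + 1)).
  by rewrite /d; ring.
by rewrite gtr_pMr// ltr_pdivrMr// mul1r ltrDl.
Qed.

(** [RS_integral] is some value selected by [xget]; it coincides with the explicit one since both
    are limits of the same uniform sums. *)
Lemma RS_integral_exp nu : RS_integral_scalar V (fun r => expR (nu * r)) (-1) 0 =
  exp_stieltjes nu 0 - exp_stieltjes nu (-1).
Proof.
have E := is_RS_integral_exp nu.
have E' := @xgetPex R^o 0 [set v | is_RS_integral (W := R) (V := R^o)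
  (fun t r => V t * r) (fun r => expR (nu * r)) (-1) 0 v] (ex_intro _ _ E).
exact: (cvg_unique _ (RS_integral_uniform E') (RS_integral_uniform E)).
Qed.

End exp_stieltjes.

(** * Square-integrable functions *)

Section square_integrable.
Context {R : realType} {X : normedModType R}.
Notation mu := (@lebesgue_measure R).
Notation D := (delay_itv : set (measurableTypeR R)).
Implicit Types (f g K : R -> X) (w : R -> R) (s t : R).

Lemma measurable_delay_itv : measurable D.
Proof. exact: measurable_itv. Qed.
Hint Extern 0 (@measurable _ _ delay_itv) => exact: measurable_delay_itv : core.

Lemma strongly_measurable_sf (u : simple_fun X) : strongly_measurable (sf_eval u).
Proof. by exists (fun=> u) => t _; exact: cvg_cst. Qed.

Lemma square_integrable_cst (y : X) : square_integrable (fun=> y).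
Proof.
split.
  exists (fun=> SimpleFun 1 (fun=> y) (fun=> measurableT)) => t _.
  by rewrite /sf_eval /= big_ord1 indicT scale1r; exact: cvg_cst.
rewrite integral_cst//.
rewrite lte_mul_pinfty// ?lee_fin ?sqr_ge0//.
exact: (mu_segment_fin (-1) 0).
Qed.

Lemma strongly_measurableB f g : strongly_measurable f -> strongly_measurable g ->
  strongly_measurable (fun t => f t - g t).
Proof.
move=> mf mg; rewrite (_ : (fun _ => _) = (fun t => -1 *: g t + f t)).
  exact: strongly_measurable_linear.
by apply/funext => t; rewrite scaleN1r addrC.
Qed.

Lemma strongly_measurableD f g : strongly_measurable f -> strongly_measurable g ->
  strongly_measurable (fun t => f t + g t).
Proof.
move=> mf mg; rewrite (_ : (fun _ => _) = (fun t => 1 *: f t + g t)).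
  exact: strongly_measurable_linear.
by apply/funext => t; rewrite scale1r.
Qed.

Lemma square_integrable_sqr f : square_integrable f ->
  mu.-integrable D (EFin \o (fun t => `|f t| ^+ 2)).
Proof.
move=> [mf foo]; apply/integrableP; split.
  apply/measurable_EFinP; apply: measurable_funX.
  exact: strongly_measurable_norm.
by under eq_integral do rewrite /= ger0_norm ?sqr_ge0//.
Qed.

Lemma square_integrable_norm f : square_integrable f ->
  mu.-integrable D (EFin \o (fun t => `|f t|)).
Proof.
move=> sf; have cst1 : mu.-integrable D (EFin \o cst (1 : R)).
  by apply: (segment_bounded_integrable (M := 1)) => // x _; rewrite normr1.
apply: le_integrable (integrable_add _ (square_integrable_sqr sf) cst1) => //.
  apply/measurable_EFinP; apply: strongly_measurable_norm.
  by case: sf.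
move=> t _ /=; rewrite lee_fin normr_id ger0_norm ?addr_ge0 ?sqr_ge0//.
have := sqr_ge0 (`|f t| - 1); have := normr_ge0 (f t); nra.
Qed.

(* AM-GM: [2 |K| <= c |K|^2 + 1 / c]; this makes [\int |K|] small on short intervals. *)
Lemma Rintegral_norm_le K c s t : square_integrable K -> 0 < c ->
  -1 <= s -> s <= t -> t <= 0 ->
  \int[mu]_(r in `[s, t]) `|K r| <=
  c * (\int[mu]_(r in D) (`|K r| ^+ 2)) + (t - s) / c.
Proof.
move=> sK c0 s1 st t0.
have K2 := square_integrable_sqr sK; have K1 := square_integrable_norm sK.
have K2st := segment_integrableS s1 t0 K2.
have K1st := segment_integrableS s1 t0 K1.
have cst1 : mu.-integrable `[s, t] (EFin \o cst (c^-1)).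
  by apply: (segment_bounded_integrable (M := `|c^-1|)).
apply: (@le_trans _ _ (\int[mu]_(r in `[s, t]) (c * `|K r| ^+ 2 + c^-1))).
  apply: le_Rintegral => //.
    exact: integrable_add (integrable_mull _ _ _) _.
  move=> x _; rewrite -(ler_pM2l c0) mulrDr mulfV ?gt_eqF//.
  have := sqr_ge0 (c * `|K x| - 1); have := normr_ge0 (K x); nra.
rewrite RintegralD//; last exact: integrable_mull.
rewrite RintegralZl// Rintegral_cst// mu_segment// (mulrC c^-1) lerD2r.
rewrite ler_wpM2l ?(ltW c0)// /Rintegral fine_le ?integrable_fin_num//.
apply: ge0_subset_integral => //.
  exact: measurable_int K2.
by move=> x /=; rewrite /delay_itv/= !in_itv/= => /andP[sx xt];
    rewrite (le_trans s1)// (le_trans xt).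
Qed.

End square_integrable.
#[global] Hint Extern 0 (@measurable _ _ delay_itv) =>
  exact: measurable_delay_itv : core.

Section ip_integrable.
Context {R : realType} {X : normedModType R} (ip : {dot X for idfun}).
Context (normE : forall x, `|x| = ip_norm ip x).
Notation mu := (@lebesgue_measure R).
Notation D := (delay_itv : set (measurableTypeR R)).
Implicit Types (f g K : R -> X) (w : R -> R).

Lemma measurable_fun_ip f g : strongly_measurable f -> strongly_measurable g ->
  measurable_fun D (fun t => ip (f t) (g t)).
Proof.
move=> mf mg; under eq_fun do rewrite ip_polar//.
apply: measurable_funM => //; apply: measurable_funB; apply: measurable_funX.
- exact: strongly_measurable_norm (strongly_measurableD mf mg).
- exact: strongly_measurable_norm (strongly_measurableB mf mg).
Qed.

Lemma integrable_wip w M f g : measurable_fun D w ->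
  (forall t, D t -> `|w t| <= M) -> square_integrable f -> square_integrable g ->
  mu.-integrable D (EFin \o (fun t => w t * ip (f t) (g t))).
Proof.
move=> mw wM sf sg.
apply: le_integrable (integrable_mull M _ (integrable_add _
  (square_integrable_sqr sf) (square_integrable_sqr sg))) => //.
  apply/measurable_EFinP; apply: measurable_funM => //.
  by apply: measurable_fun_ip; [case: sf|case: sg].
move=> t Dt /=; rewrite lee_fin.
have M0 : 0 <= M by rewrite (le_trans _ (wM t Dt)).
rewrite normrM (le_trans _ (ler_norm _))// ler_pM ?wM//.
rewrite (le_trans (cauchy_schwarz normE _ _))//.
have := sqr_ge0 (`|f t| - `|g t|); have := sqr_ge0 (`|f t| + `|g t|); nra.
Qed.

Lemma sf_ip_integrable (u : simple_fun X) y :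
  mu.-integrable D (EFin \o (fun t => ip (sf_eval u t) y)) /\
  \int[mu]_(t in D) ip (sf_eval u t) y = ip (sf_integral u) y.
Proof.
case: u => n A c mA; rewrite /sf_integral /sf_eval /=.
have I1 i : mu.-integrable D (EFin \o (\1_(A i) : R -> R)).
  apply: (segment_bounded_integrable (M := 1)).
    exact: measurable_funTS.
  by move=> x _; rewrite indicE; case: (_ \in _); rewrite ?normr1 ?normr0.
elim: n => [|n [IHi IHn]].
  rewrite (_ : (fun t => ip _ y) = cst (0 : R)); last first.
    by apply/funext => t; rewrite big_ord0 linear0l.
  rewrite big_ord0 linear0l; split; last by rewrite Rintegral_cst// mul0r.
  by apply: (segment_bounded_integrable (M := 0)) => // x _; rewrite normr0.
rewrite (_ : (fun t => ip _ y) =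
    (fun t => ip (\sum_(i < n) \1_(A i) t *: c i) y + ip (c n) y * \1_(A n) t));
  last by apply/funext => t; rewrite big_ord_recr ipDl ipZl mulrC.
split; first by apply: integrable_add => //; exact: integrable_mull.
rewrite RintegralD//; last exact: integrable_mull.
rewrite IHn RintegralZl// big_ord_recr ipDl ipZl/= mulrC; congr (_ + _ * _).
rewrite /Rintegral integral_indic//; exact: mA.
Qed.

(** Both sides are limits of [ip (sf_integral (s n)) y], by Cauchy-Schwarz applied to
    [f - sf_eval (s n)]. This is how the Bochner integrals in the weak derivative become integrals
    of real functions. *)
Lemma bochner_integral_ip f v y : is_bochner_integral f v ->
  mu.-integrable D (EFin \o (fun t => ip (f t) y)) ->
  \int[mu]_(t in D) ip (f t) y = ip v y.
Proof.
move=> [mf [s [fs sv]]] fi.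
have cv : ip (sf_integral (s n)) y @[n --> \oo] --> ip v y.
  apply/cvgrPdist_lt => e e0.
  have e1 : 0 < e / (`|y| + 1) by rewrite divr_gt0// ltr_wpDl.
  move/cvgrPdist_lt : sv => /(_ _ e1); apply: filterS => n vn.
  rewrite -ipBl; apply: le_lt_trans (cauchy_schwarz normE _ _) _.
  rewrite ltr_pdivlMr ?ltr_wpDl// in vn; apply: le_lt_trans vn.
  by rewrite ler_wpM2l// lerDl.
apply: (cvg_unique _ _ cv) => //; apply/cvgrPdist_le => e e0.
have e1 : (0 < (e / (`|y| + 1))%:E)%E by rewrite lte_fin divr_gt0// ltr_wpDl.
(* Convergence to 0 in the extended reals gives finite integrals only from some [n] on. *)
move/fine_cvgP : fs => [fin /cvgrPdist_lt].
move=> /(_ _ e1); move=> fs; near=> n.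
have [si <-] := sf_ip_integrable (s n) y.
have snf : (\int[mu]_(t in D) `|f t - sf_eval (s n) t|%:E)%E \is a fin_num.
  by near: n.
have mfs := strongly_measurableB mf (strongly_measurable_sf (s n)).
have nfi : mu.-integrable D (EFin \o (fun t => `|f t - sf_eval (s n) t|)).
  apply/integrableP; split.
    by apply/measurable_EFinP; exact: strongly_measurable_norm.
  under eq_integral do rewrite /= normr_id.
  by rewrite -ge0_fin_numE// integral_ge0.
rewrite -RintegralB//.
apply: (@le_trans _ _ (\int[mu]_(t in D) (`|y| * `|f t - sf_eval (s n) t|))).
  apply: le_normr_Rintegral_ae => //.
  - exact: integrable_sub.
  - exact: integrable_mull.
  - by apply: aeW => x _; rewrite -ipBl mulrC; exact: cauchy_schwarz.
rewrite RintegralZl//.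
have : \int[mu]_(t in D) `|f t - sf_eval (s n) t| < e / (`|y| + 1).
  near: n; apply: filterS fs => n; rewrite /= sub0r normrN.
  by apply: le_lt_trans; exact: ler_norm.
rewrite ltr_pdivlMr ?ltr_wpDl// => /ltW; apply: le_trans; rewrite mulrC.
by rewrite ler_wpM2l// ?lerDl// Rintegral_ge0.
Unshelve. all: by end_near. Qed.

End ip_integrable.

(** * Continuous functions on a segment *)

Section uniform_continuity.
Context {R : realType} {X : normedModType R}.
Implicit Types (f : R -> X).

Lemma segment_uniform_continuity (a b : R) f :
  {within `[a, b], continuous f} -> forall e : R, 0 < e ->
  exists2 d, 0 < d & forall s t, s \in `[a, b] -> t \in `[a, b] ->
    `|s - t| < d -> `|f s - f t| < e.
Proof.
move=> cf e e0; have e2 : 0 < e / 2 by rewrite divr_gt0.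
have /compact_near_coveringP cov := @segment_compact R a b.
(* Compactness in near-covering form, with the modulus [d] as the parameter: a [d] that works near
   each point yields one that works for all [s]. *)
have := cov R (0^'+) (fun d s => s \in `[a, b] -> forall t, t \in `[a, b] ->
  `|s - t| < d -> `|f s - f t| < e) _.
case.
  move=> x abx.
  have /subspace_continuousP/(_ x abx)/cvgrPdist_lt/(_ _ e2) := cf.
  rewrite near_withinE => -[r /= r0 xr].
  exists (ball x (r / 2), [set d | 0 < d < r / 2]) => /=.
    split; first by apply: nbhsx_ballx; rewrite divr_gt0.
    near=> d; apply/andP; split; near: d; first exact: nbhs_right_gt.
    by apply: nbhs_right_lt; rewrite divr_gt0.
  move=> [s d] /= [xs /andP[d0 dr]] abs t abt std.
  rewrite /ball/= in xs.
  have xsr : `|x - s| < r by rewrite (lt_le_trans xs)// ler_pdivrMr// ler_pMr// ler1n.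
  have xtr : `|x - t| < r.
    rewrite -(subrKA s) (le_lt_trans (ler_normD _ _))//.
    by rewrite [ltRHS](splitr r) ltrD// (lt_trans std).
  have := xr s xsr abs; have := xr t xtr abt => ft fs.
  rewrite -(subrKA (f x)) (le_lt_trans (ler_normD _ _))//.
  by rewrite [ltRHS](splitr e) ltrD// distrC.
move=> d /= d0 dP; exists (d / 2); first by rewrite divr_gt0.
move=> s t abs abt std; apply: (dP (d / 2)) => //=.
- by rewrite sub0r normrN gtr0_norm ?divr_gt0// ltr_pdivrMr// ltr_pMr// ltr1n.
- by rewrite divr_gt0.
Unshelve. all: by end_near. Qed.

Lemma segment_bounded (a b : R) f :
  {within `[a, b], continuous f} -> exists2 M, 0 <= M &
  forall s, s \in `[a, b] -> `|f s| <= M.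
Proof.
move=> cf.
have [ab|ba] := leP a b; last first.
  exists 0 => // s; rewrite in_itv/= => /andP[as_ sb].
  by have := lt_le_trans ba (le_trans as_ sb); rewrite ltxx.
have cn : {within `[a, b], continuous (fun s => `|f s|)}.
  by move=> s; apply: cvg_norm; exact: cf.
have [c cab cM] := EVT_max ab cn.
by exists `|f c|.
Qed.

End uniform_continuity.

(** * Test functions *)

Section ramp.
Context {R : realType}.
Implicit Types (x h m k r : R) (f F : R -> R).

(** A quadratic bound on the remainder handles the kinks of the piecewise quadratic [ramp] without
    treating them separately. *)
Lemma is_derive_quadratic F f C x :
  (forall h, `|F (x + h) - F x - f x * h| <= C * h ^+ 2) ->
  is_derive x 1 F (f x).
Proof.
move=> Fq.
have cv : h^-1 *: (F (h *: 1 + x) - F x) @[h --> 0^'] --> f x.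
  apply/cvgrPdist_le => e e0; near=> h.
  have h0 : h != 0 by near: h; exact: nbhs_dnbhs_neq.
  have hn : 0 < `|h| by rewrite normr_gt0.
  have -> : f x - h^-1 *: (F (h *: 1 + x) - F x) =
      - (h^-1 * (F (x + h) - F x - f x * h)).
    by rewrite [h *: 1]mulr1 [_ *: _]/GRing.scale/= (addrC h); field.
  rewrite normrN normrM normfV ler_pdivrMl// (le_trans (Fq h))//.
  rewrite -real_normK ?num_real// expr2 mulrCA ler_pM2l//.
  have : `|h| < e / (`|C| + 1).
    by near: h; apply: dnbhs0_lt; rewrite divr_gt0// ltr_wpDl.
  rewrite ltr_pdivlMr ?ltr_wpDl// => /ltW; apply: le_trans.
  by rewrite mulrC ler_wpM2l// (le_trans (ler_norm C))// lerDl.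
apply: DeriveDef; first by apply/cvg_ex; exists (f x).
exact/cvg_lim.
Unshelve. all: by end_near. Qed.

Let pos x : R := Num.max x 0.

(* A C^1 step: it rises from 0 to 1 on [[c, c + d]]. *)
Definition ramp (c d r : R) : R :=
  let u := (r - c) / d in
  2 * (pos u ^+ 2 - 2 * pos (u - 1 / 2) ^+ 2 + pos (u - 1) ^+ 2).

(** The hat function on [[c, c + d]] with peak [2 / d] at the midpoint: it has mass 1 and
    approximates a Dirac mass at [c]. *)
Definition dramp (c d r : R) : R :=
  let u := (r - c) / d in
  4 / d * (pos u - 2 * pos (u - 1 / 2) + pos (u - 1)).

Let posP x : (pos x = x /\ 0 <= x) \/ (pos x = 0 /\ x <= 0).
Proof.
rewrite /pos; have [x0|x0] := leP 0 x; [left|right].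
  by split.
by split; rewrite // ltW.
Qed.

Let pos_quadratic x h : `|pos (x + h) ^+ 2 - pos x ^+ 2 - 2 * pos x * h| <= h ^+ 2.
Proof.
rewrite ler_norml; case: (posP x) => -[-> hx]; case: (posP (x + h)) => -[-> hh];
  apply/andP; split; nra.
Qed.

Lemma is_derive_ramp c d r : 0 < d -> is_derive r 1 (ramp c d) (dramp c d r).
Proof.
(* The three squares carry coefficients 1, 2, 1 and an overall factor 2, hence
   [8 * (h / d) ^+ 2]. *)
move=> d0; apply: (@is_derive_quadratic _ _ (8 / d ^+ 2)) => h.
rewrite /ramp /dramp; set u := (r - c) / d.
have -> : (r + h - c) / d = u + h / d by rewrite /u; field; rewrite gt_eqF.
set k := h / d.
have -> : u + k - 1 / 2 = (u - 1 / 2) + k by ring.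
have -> : u + k - 1 = (u - 1) + k by ring.
have := pos_quadratic u k; have := pos_quadratic (u - 1 / 2) k.
have := pos_quadratic (u - 1) k; rewrite !ler_norml.
have -> : 8 / d ^+ 2 * h ^+ 2 = 8 * k ^+ 2.
  by rewrite /k; field; rewrite gt_eqF.
have -> : 4 / d * (pos u - 2 * pos (u - 1 / 2) + pos (u - 1)) * h =
    4 * (pos u - 2 * pos (u - 1 / 2) + pos (u - 1)) * k.
  by rewrite /k; ring.
move=> /andP[a1 a2] /andP[b1 b2] /andP[c1 c2]; apply/andP; split; lra.
Qed.

Lemma continuous_dramp c d : continuous (dramp c d).
Proof.
have cp k : continuous (fun r => pos ((r - c) / d - k)).
  move=> r; apply: (@continuous_max _ _ (fun r => (r - c) / d - k) (cst 0)).
    apply: cvgB; last exact: cvg_cst.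
    apply: cvgMl; apply: cvgB; [exact: cvg_id|exact: cvg_cst].
  exact: cvg_cst.
move=> r; apply: cvgMr; apply: cvgD; last exact: cp.
apply: cvgB; last by apply: cvgMr; exact: cp.
by have := cp 0 r; under eq_fun do rewrite subr0.
Qed.

Lemma ramp_left c d r : 0 < d -> r <= c -> ramp c d r = 0.
Proof.
move=> d0 rc; rewrite /ramp; set u := (r - c) / d.
have u0 : u <= 0 by rewrite /u mulr_le0_ge0 ?subr_le0// invr_ge0 ltW.
case: (posP u) => -[-> hx]; case: (posP (u - 1 / 2)) => -[-> hy];
  case: (posP (u - 1)) => -[-> hz]; nra.
Qed.

Lemma ramp_right c d r : 0 < d -> c + d <= r -> ramp c d r = 1.
Proof.
move=> d0 rc; rewrite /ramp; set u := (r - c) / d.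
have u1 : 1 <= u by rewrite /u ler_pdivlMr// mul1r lerBrDl.
case: (posP u) => -[-> hx]; case: (posP (u - 1 / 2)) => -[-> hy];
  case: (posP (u - 1)) => -[-> hz]; nra.
Qed.

Lemma ramp_itv c d r : 0 <= ramp c d r <= 1.
Proof.
rewrite /ramp; set u := (r - c) / d.
case: (posP u) => -[-> hx]; case: (posP (u - 1 / 2)) => -[-> hy];
  case: (posP (u - 1)) => -[-> hz]; apply/andP; split; nra.
Qed.

Lemma dramp_ge0 c d r : 0 < d -> 0 <= dramp c d r.
Proof.
move=> d0; rewrite /dramp; set u := (r - c) / d; apply: mulr_ge0.
  by rewrite divr_ge0// ltW.
case: (posP u) => -[-> hx]; case: (posP (u - 1 / 2)) => -[-> hy];
  case: (posP (u - 1)) => -[-> hz]; nra.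
Qed.

Lemma dramp_out c d r : 0 < d -> ~ (c <= r <= c + d) -> dramp c d r = 0.
Proof.
move=> d0 rcd; rewrite /dramp; set u := (r - c) / d.
have [u0|u1] : u <= 0 \/ 1 <= u.
  have [rc|cr] := leP c r.
    right; rewrite /u ler_pdivlMr// mul1r lerBrDl ltW// ltNge.
    by apply/negP => rd; apply: rcd; rewrite rc rd.
  by left; rewrite /u mulr_le0_ge0 ?subr_le0 ?(ltW cr)// invr_ge0 ltW.
- by case: (posP u) => -[-> hx]; case: (posP (u - 1 / 2)) => -[-> hy];
    case: (posP (u - 1)) => -[-> hz]; rewrite (_ : _ + _ = 0) ?mulr0//; lra.
- by case: (posP u) => -[-> hx]; case: (posP (u - 1 / 2)) => -[-> hy];
    case: (posP (u - 1)) => -[-> hz]; rewrite (_ : _ + _ = 0) ?mulr0//; lra.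
Qed.

End ramp.

(** * Integrals against ramps and their derivatives *)

Section weak_derivative.
Context {R : realType} {X : normedModType R}.
Notation mu := (@lebesgue_measure R).
Notation D := (delay_itv : set (measurableTypeR R)).
Implicit Types (b g : R -> R) (s t c d e nu : R).

Lemma Rintegral_norm_small (K : R -> X) : square_integrable K ->
  forall e, 0 < e -> exists2 d, 0 < d & forall s t, -1 <= s -> s <= t -> t <= 0 ->
    t - s < d -> \int[mu]_(r in `[s, t]) `|K r| < e.
Proof.
move=> sK e e0; set N := \int[mu]_(r in D) (`|K r| ^+ 2).
have N0 : 0 <= N by apply: Rintegral_ge0 => x _; exact: sqr_ge0.
(* This is the [c] of [Rintegral_norm_le]: it makes the term [c * N] at most [e / 2], and the length
   bound [c * (e / 2)] makes the other term less than [e / 2]. *)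
have c0 : 0 < e / (2 * (N + 1)) by rewrite divr_gt0// mulr_gt0// ltr_wpDl.
exists (e / (2 * (N + 1)) * (e / 2)); first by rewrite mulr_gt0// divr_gt0.
move=> s t s1 st t0 tsd; apply: le_lt_trans (Rintegral_norm_le sK c0 s1 st t0) _.
rewrite [ltRHS](splitr e) ler_ltD//; last by rewrite ltr_pdivrMr// mulrC.
rewrite -/N (_ : _ * N = e / 2 * (N / (N + 1))); last first.
  by field; rewrite gt_eqF// ltr_wpDl.
by rewrite ler_piMr ?divr_ge0 ?(ltW e0)// ler_pdivrMr ?ltr_wpDl// mul1r lerDl.
Qed.

Lemma measurable_ramp c d : 0 < d -> measurable_fun D (ramp c d).
Proof.
move=> d0; apply: measurable_funTS; apply: continuous_measurable_fun => x.
apply: differentiable_continuous; apply/derivable1_diffP.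
have dr := is_derive_ramp c x d0; exact: ex_derive.
Qed.

Lemma measurable_dramp c d : measurable_fun D (dramp c d).
Proof.
apply: measurable_funTS; apply: continuous_measurable_fun.
exact: continuous_dramp.
Qed.

Lemma integrable_mulbounded g b M : measurable_fun D g ->
  (forall r, D r -> `|g r| <= M) -> mu.-integrable D (EFin \o b) ->
  mu.-integrable D (EFin \o (fun r => g r * b r)).
Proof.
move=> mg gM bi; apply: le_integrable (integrable_mull M _ bi) => //.
  apply/measurable_EFinP; apply: measurable_funM => //.
  by apply/measurable_EFinP; exact: measurable_int bi.
move=> r Dr; rewrite /= lee_fin !normrM ler_wpM2r//.
exact: le_trans (gM r Dr) (ler_norm M).
Qed.

Lemma ramp_bounded c d r : `|ramp c d r| <= 1.
Proof. by have /andP[r0 r1] := ramp_itv c d r; rewrite ger0_norm. Qed.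

Lemma dramp_bounded c d : exists M, forall r, D r -> `|dramp c d r| <= M.
Proof.
have cd : {within `[-1, 0], continuous (dramp c d : R -> R^o)}.
  by apply: continuous_subspaceT; exact: continuous_dramp.
by have [M _ dM] := segment_bounded cd; exists M => r Dr; exact: dM.
Qed.

(** The ramp differs from the indicator of [[c, 0]] on [[c, c + d]] only, and there by at most 1. *)
Lemma Rintegral_ramp c d b : 0 < d -> -1 <= c -> c + d <= 0 ->
  mu.-integrable D (EFin \o b) ->
  `|\int[mu]_(r in D) (ramp c d r * b r) - \int[mu]_(r in `[c, 0]) b r| <=
  \int[mu]_(r in `[c, c + d]) `|b r|.
Proof.
move=> d0 c1 cd0 bi.
have ri : mu.-integrable D (EFin \o (fun r => ramp c d r * b r)).
  apply: (integrable_mulbounded (M := 1)) => //; first exact: measurable_ramp.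
  by move=> r _; exact: ramp_bounded.
have ccd : c <= c + d by rewrite lerDl ltW.
have c0 : c <= 0 by rewrite (le_trans ccd).
rewrite /delay_itv (Rintegral_split c1 c0)//.
rewrite (@eq_Rintegral _ _ _ mu `[-1, c] (cst 0)); last first.
  by move=> r; rewrite inE/= in_itv/= => /andP[_ rc]; rewrite ramp_left// mul0r.
rewrite Rintegral_cst// mul0r add0r.
have ri' := segment_integrableS c1 (lexx 0) ri.
have bi' := segment_integrableS c1 (lexx 0) bi.
rewrite (Rintegral_split ccd cd0 ri') (Rintegral_split ccd cd0 bi').
rewrite (@eq_Rintegral _ _ _ mu `[c + d, 0] b); last first.
  by move=> r; rewrite inE/= in_itv/= => /andP[cr _]; rewrite ramp_right// mul1r.
rewrite opprD addrACA subrr addr0.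
have ri2 := segment_integrableS (lexx c) cd0 ri'.
have bi2 := segment_integrableS (lexx c) cd0 bi'.
rewrite -RintegralB//; apply: le_trans (le_normr_Rintegral _ _) _ => //.
  exact: integrable_sub.
apply: le_Rintegral => //.
- by apply: integrable_norm; exact: integrable_sub.
- exact: integrable_norm.
- move=> r _; rewrite -{2}(mul1r (b r)) -mulrBl normrM ler_piMl//.
  have /andP[r0 r1] := ramp_itv c d r.
  by rewrite distrC ger0_norm ?subr_ge0// gerBl.
Qed.

(** [dramp c d] is a probability density carried by [[c, c + d]], where almost every value of [b] is
    within [e] of [a]. *)
Lemma Rintegral_dramp c d b e a : 0 < d -> -1 <= c -> c + d <= 0 ->
  mu.-integrable D (EFin \o b) -> 0 <= e ->
  {ae mu, forall r, D r -> c <= r <= c + d -> `|b r - a| <= e} ->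
  `|\int[mu]_(r in D) (dramp c d r * b r) - a| <= e.
Proof.
move=> d0 c1 cd0 bi e0 bae.
have [M dM] := dramp_bounded c d.
have di : mu.-integrable D (EFin \o (fun r => dramp c d r * b r)).
  by apply: (integrable_mulbounded (M := M)) => //; exact: measurable_dramp.
have d1i : mu.-integrable D (EFin \o dramp c d).
  by apply: (segment_bounded_integrable (M := M)) => //; exact: measurable_dramp.
have d1 : \int[mu]_(r in D) dramp c d r = 1.
  rewrite /delay_itv (Rintegral_FTC _ (fun x => is_derive_ramp c x d0)
    (@continuous_dramp _ c d)) ?lerN10//.
  by rewrite ramp_right// ramp_left// subr0.
rewrite -{1}(mulr1 a) -d1 -RintegralZl// -RintegralB//; last exact: integrable_mull.
rewrite -(mulr1 e) -d1 -RintegralZl//.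
apply: le_normr_Rintegral_ae => //.
- by apply: integrable_sub => //; exact: integrable_mull.
- exact: integrable_mull.
- by move=> r _; rewrite mulr_ge0// dramp_ge0.
- move: bae; apply: filterS => r br Dr.
  have [rcd|/(dramp_out d0)->] := pselect (c <= r <= c + d); last first.
    by rewrite !(mul0r, mulr0) subr0 normr0.
  rewrite (mulrC a) -mulrBr normrM ger0_norm ?dramp_ge0// mulrC.
  by rewrite ler_wpM2r ?dramp_ge0// br.
Qed.

End weak_derivative.

(** * Fundamental theorem of calculus for weak derivatives *)

(** Test functions vanish near -1 and 0, while [s = -1] and [t = 0] have to be allowed. The ramps,
    of width [k], therefore start at points [s'] and [t'] moved inwards by [k] and [2 * k]; a
    quarter of the length leaves room for these moves. *)
Lemma inner_segment (R : realType) (s t d : R) :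
  -1 <= s -> s < t -> t <= 0 -> 0 < d -> exists k s' t',
  [/\ 0 < k, k < d, -1 < s', s' + k <= 0 & t' + k < 0] /\
  [/\ s <= s', s' <= t', t' <= t, s' - s < d & t - t' < d].
Proof.
move=> s1 st t0 d0; pose k := Num.min (t - s) d / 4.
have k0 : 0 < k by rewrite divr_gt0// !lt_min subr_gt0 st d0.
have kts : 4 * k <= t - s by rewrite mulrCA divff// mulr1 ge_min lexx.
have kd : 4 * k <= d by rewrite mulrCA divff// mulr1 !ge_min lexx orbT.
exists k, (s + k), (t - 2 * k); clearbody k.
by split; split; lra.
Qed.

Section weak_FTC.
Context {R : realType} {X : normedModType R} (ip : {dot X for idfun}).
Context (normE : forall x, `|x| = ip_norm ip x).
Notation mu := (@lebesgue_measure R).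
Notation D := (delay_itv : set (measurableTypeR R)).
Context (F G : L2 X) (f : R -> X) (nu : R).
Context (FG : weak_derivative F G) (Ff : is_continuous_rep F f).
Implicit Types (s t c d e r : R) (y : X).

Lemma repr_square_integrable (H : L2 X) : square_integrable (repr H).
Proof. by case: (repr H) => g /= /[!inE]. Qed.

(* [damped] has weak derivative [wgt r *: damped_deriv r]. *)
Definition wgt r : R := expR (- nu * r).
Definition damped r : X := wgt r *: f r.
Definition damped_deriv r : X := repr G r - nu *: repr F r.

Lemma damped_deriv_square_integrable : square_integrable damped_deriv.
Proof.
rewrite (_ : damped_deriv = (fun r => - nu *: repr F r + repr G r)).
  by apply: square_integrable_linear; exact: repr_square_integrable.
by apply/funext => r; rewrite /damped_deriv scaleNr addrC.
Qed.

Lemma continuous_wgt : continuous wgt.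
Proof. exact: continuous_expRM. Qed.

Lemma measurable_wgt : measurable_fun D wgt.
Proof.
by apply: measurable_funTS; apply: continuous_measurable_fun; exact: continuous_wgt.
Qed.

Lemma wgt_ge0 r : 0 <= wgt r. Proof. exact: expR_ge0. Qed.

Lemma wgt_le r : D r -> `|wgt r| <= expR `|nu|.
Proof.
rewrite /delay_itv/= in_itv/= => Dr.
by rewrite ger0_norm ?wgt_ge0// -(normrN nu); exact: expRM_le.
Qed.

Lemma continuous_damped : {within `[-1, 0], continuous damped}.
Proof.
have cw : {within `[-1, 0], continuous (wgt : R -> R^o)}.
  by apply: continuous_subspaceT; exact: continuous_wgt.
move=> r; apply: cvgZ; [exact: cw|exact: Ff.1].
Qed.

Let A y r := wgt r * ip (repr F r) y.
Let B y r := wgt r * ip (damped_deriv r) y.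

Let integrable_A y : mu.-integrable D (EFin \o A y).
Proof.
apply: (integrable_wip normE measurable_wgt wgt_le (repr_square_integrable F)).
exact: square_integrable_cst.
Qed.

Lemma integrable_damped_deriv y :
  mu.-integrable D (EFin \o (fun r => wgt r * ip (damped_deriv r) y)).
Proof.
apply: (integrable_wip normE measurable_wgt wgt_le damped_deriv_square_integrable).
exact: square_integrable_cst.
Qed.

(** The factor [wgt] belongs to the test function so that its derivative contributes [- nu] times
    the test function itself; this is what turns [G] into [G - nu F]. *)
Lemma C1_test_ramp s t d : -1 < s -> s <= t -> 0 < d -> t + d < 0 ->
  C1_test (fun r => (ramp s d r - ramp t d r) * wgt r) /\
  derive1 (fun r => (ramp s d r - ramp t d r) * wgt r) =
    (fun r => (dramp s d r - dramp t d r) * wgt r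
              - nu * ((ramp s d r - ramp t d r) * wgt r)).
Proof.
move=> s1 st d0 td; set psi := fun r => _.
set dpsi := fun r => (dramp s d r - dramp t d r) * wgt r - _.
have dP r : is_derive r 1 psi (dpsi r).
  have ds := is_derive_ramp s r d0; have dt := is_derive_ramp t r d0.
  have := is_deriveM (is_deriveB ds dt) (is_derive_expRM (- nu) r).
  move=> h; apply: (is_derive_eq h).
  by rewrite /dpsi /wgt /GRing.scale/= !fctE; ring.
have dE : derive1 psi = dpsi.
  by apply/funext => r; rewrite derive1E; have h := dP r; exact: derive_val.
split=> //; split.
- by move=> r; have h := dP r; exact: ex_derive.
- have cpsi : continuous psi.
    move=> r; apply: differentiable_continuous; apply/derivable1_diffP.
    have h := dP r; exact: ex_derive.
  rewrite dE => r; apply: cvgB; last by apply: cvgMr; exact: cpsi.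
  apply: cvgM; last exact: continuous_wgt.
  by apply: cvgB; exact: continuous_dramp.
- exists s, (t + d); split => // r rst; rewrite /psi.
  have [rs|sr] := leP r s.
    by rewrite !ramp_left ?subrr ?mul0r// (le_trans rs).
  have [rt|tr] := leP r (t + d).
    by exfalso; apply: rst; rewrite rt ltW.
  rewrite !ramp_right ?subrr ?mul0r// ltW//.
  by rewrite (le_lt_trans _ tr)// lerD2r.
Qed.

(** The two Bochner integrals in [weak_derivative] are [v] and [- v]. Their pairings with [y]
    cancel, and the [- nu] part of the first is absorbed in [B]. *)
Let weak_ramp s t d y : -1 < s -> s <= t -> 0 < d -> t + d < 0 ->
  \int[mu]_(r in D) (dramp s d r * A y r) - \int[mu]_(r in D) (dramp t d r * A y r)
  + (\int[mu]_(r in D) (ramp s d r * B y r)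
     - \int[mu]_(r in D) (ramp t d r * B y r)) = 0.
Proof.
move=> s1 st d0 td; have [C1 dE] := C1_test_ramp s1 st d0 td.
have [v [vF vG]] := FG C1.
have iA := integrable_A y; have iB := integrable_damped_deriv y.
have iR c b : mu.-integrable D (EFin \o b) ->
    mu.-integrable D (EFin \o (fun r => ramp c d r * b r)).
  move=> bi; apply: (integrable_mulbounded (M := 1)) => //.
    exact: measurable_ramp.
  by move=> r _; exact: ramp_bounded.
have iDR c b : mu.-integrable D (EFin \o b) ->
    mu.-integrable D (EFin \o (fun r => dramp c d r * b r)).
  move=> bi; have [M dM] := dramp_bounded c d.
  apply: (integrable_mulbounded (M := M)) => //; exact: measurable_dramp.
have iG : mu.-integrable D (EFin \o (fun r => wgt r * ip (repr G r) y)).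
  apply: (integrable_wip normE measurable_wgt wgt_le (repr_square_integrable G)).
  exact: square_integrable_cst.
pose gF r := (dramp s d r * A y r - dramp t d r * A y r) -
  nu * (ramp s d r * A y r - ramp t d r * A y r).
have gFE : (fun r => ip (derive1 (fun r => (ramp s d r - ramp t d r) * wgt r) r
    *: repr F r) y) = gF.
  by apply/funext => r; rewrite dE ipZl /gF /A; ring.
pose gG r := ramp s d r * (wgt r * ip (repr G r) y) -
  ramp t d r * (wgt r * ip (repr G r) y).
have gGE : (fun r => ip (((ramp s d r - ramp t d r) * wgt r) *: repr G r) y) = gG.
  by apply/funext => r; rewrite ipZl /gG; ring.
have igF : mu.-integrable D (EFin \o gF).
  apply: integrable_sub => //; first by apply: integrable_sub => //; exact: iDR.
  by apply: integrable_mull => //; apply: integrable_sub => //; exact: iR.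
have igG : mu.-integrable D (EFin \o gG).
  by apply: integrable_sub => //; exact: iR.
have := bochner_integral_ip normE (y := y) vF; rewrite gFE => /(_ igF) EF.
have := bochner_integral_ip normE (y := y) vG; rewrite gGE => /(_ igG) EG.
rewrite -!RintegralB//; do ?[exact: iDR | exact: iR].
rewrite -RintegralD//; last 2 first.
- by apply: integrable_sub => //; exact: iDR.
- by apply: integrable_sub => //; exact: iR.
transitivity (\int[mu]_(r in D) (gF r + gG r)).
  apply: eq_Rintegral => r _.
  by rewrite /gF /gG /A /B /damped_deriv !ip_linE; ring.
by rewrite RintegralD// EF EG ipNl subrr.
Qed.

(* Test the weak derivative against the difference of a ramp at [s] and a ramp at
   [t], whose derivatives approximate Dirac masses. *)
Lemma weak_FTC s t y : -1 <= s -> s <= t -> t <= 0 ->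
  ip (damped t - damped s) y =
  \int[mu]_(r in `[s, t]) (wgt r * ip (damped_deriv r) y).
Proof.
move=> s1; rewrite le_eqVlt => /orP[/eqP->|st] t0.
  by rewrite set_itv1 Rintegral_set1 subrr linear0l.
(* Eight errors of size [e]: two averages against [dramp], two replacements of a ramp by an
   indicator, two end pieces of the integral, and two moves of the end points to [s'] and [t']. *)
suff small e : 0 < e ->
    `|ip (damped t - damped s) y - \int[mu]_(r in `[s, t]) B y r| <= 8 * e.
  apply/eqP; rewrite -subr_eq0 -normr_eq0; apply/eqP/le_anti; rewrite normr_ge0 andbT.
  apply/ler_addgt0Pl => e e0; rewrite addr0.
  have := small (e / 8); rewrite divr_gt0// => /(_ isT).
  by rewrite mulrCA divff ?mulr1.
move=> e0; set a := fun r => ip (damped r) y.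
have iA := integrable_A y; have iB := integrable_damped_deriv y.
have [d1 d10 a_small] : exists2 d1, 0 < d1 & forall p q, D p -> D q ->
    `|p - q| < d1 -> `|a p - a q| <= e.
  have y1 : 0 < `|y| + 1 by rewrite ltr_wpDl.
  have [d1 d10 d1P] := segment_uniform_continuity continuous_damped (divr_gt0 e0 y1).
  exists d1 => // p q Dp Dq pq; rewrite /a -ipBl.
  have := d1P p q Dp Dq pq; rewrite ltr_pdivlMr// => /ltW; apply: le_trans.
  by rewrite (le_trans (cauchy_schwarz normE _ _))// ler_wpM2l// lerDl.
have [d2 d20 B_small] : exists2 d2, 0 < d2 & forall p q, -1 <= p -> p <= q ->
    q <= 0 -> q - p < d2 -> \int[mu]_(r in `[p, q]) `|B y r| <= e.
  set k := expR `|nu| * `|y|; have k0 : 0 <= k by rewrite mulr_ge0// expR_ge0.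
  have k1 : 0 < k + 1 by rewrite ltr_wpDl.
  have [d2 d20 d2P] := Rintegral_norm_small damped_deriv_square_integrable
    (divr_gt0 e0 k1).
  exists d2 => // p q p1 pq q0 qp.
  have := d2P p q p1 pq q0 qp; rewrite ltr_pdivlMr// mulrC => /ltW; apply: le_trans.
  have iL := segment_integrableS p1 q0
    (square_integrable_norm damped_deriv_square_integrable).
  rewrite -RintegralZl//; apply: le_Rintegral => //.
  - by apply: integrable_norm; exact: segment_integrableS iB.
  - exact: integrable_mull.
  - move=> r /= pqr; have Dr : D r.
      move: pqr; rewrite /delay_itv/= !in_itv/= => /andP[pr rq].
      by rewrite (le_trans p1 pr) (le_trans rq q0).
    rewrite normrM (@le_trans _ _ (k * `|damped_deriv r|))//; last first.
      by rewrite ler_wpM2r// lerDl.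
    rewrite /k -mulrA ler_pM// ?wgt_le// mulrC.
    exact: cauchy_schwarz.
have [] := @inner_segment _ s t (Num.min d1 d2) s1 st t0; first by rewrite lt_min d10.
move=> k [s' [t' [[k0 kd s's s'k t'k] [st' s't' t't sd td]]]].
move: kd sd td; rewrite !lt_min => /andP[kd1 kd2] /andP[sd1 sd2] /andP[td1 td2].
have s'1 := le_trans s1 st'; have t'1 := le_trans s'1 s't'.
have t'0 := le_trans t't t0; have s'0 := le_trans s't' t'0.
have kE c : c + k - c = k by rewrite addrC addKr.
have ck c : c <= c + k by rewrite lerDl ltW.
have tD p : -1 <= p -> p <= 0 -> D p.
  by move=> p1 p0; rewrite /delay_itv/= in_itv/= p1 p0.
have near_a c : -1 <= c -> c + k <= 0 ->
    {ae mu, forall r, D r -> c <= r <= c + k -> `|A y r - a c| <= e}.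
  move=> c1 ck0; have := Ff.2; apply: filterS => r Fr Dr /andP[cr rc].
  have Fr' : repr F r = f r := Fr Dr.
  have -> : A y r = a r by rewrite /A /a /damped ipZl Fr'.
  have c0 : c <= 0 by rewrite (le_trans _ ck0).
  apply: a_small => //; first exact: tD.
  by rewrite ger0_norm ?subr_ge0// (le_lt_trans _ kd1)// lerBlDl.
have Ds := Rintegral_dramp k0 s'1 s'k iA (ltW e0) (near_a _ s'1 s'k).
have Dt := Rintegral_dramp k0 t'1 (ltW t'k) iA (ltW e0) (near_a _ t'1 (ltW t'k)).
have Bs : \int[mu]_(r in `[s', s' + k]) `|B y r| <= e.
  by apply: B_small; rewrite ?kE.
have Bt : \int[mu]_(r in `[t', t' + k]) `|B y r| <= e.
  by apply: B_small; rewrite ?kE// ltW.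
have Rs := le_trans (Rintegral_ramp k0 s'1 s'k iB) Bs.
have Rt := le_trans (Rintegral_ramp k0 t'1 (ltW t'k) iB) Bt.
have absI p q : -1 <= p -> p <= q -> q <= 0 -> q - p < d2 ->
    `|\int[mu]_(r in `[p, q]) B y r| <= e.
  move=> p1 pq q0 qp; apply: le_trans (B_small p q p1 pq q0 qp).
  by apply: le_normr_Rintegral => //; exact: segment_integrableS iB.
have I1 := absI s s' s1 st' s'0 sd2.
have I2 := absI t' t t'1 t't t0 td2.
have a1 : `|a s' - a s| <= e.
  apply: a_small; [exact: tD|exact: tD (le_trans st' s'0)|].
  by rewrite ger0_norm ?subr_ge0.
have a2 : `|a t - a t'| <= e.
  apply: a_small; [exact: tD (le_trans t'1 t't) t0|exact: tD|].
  by rewrite ger0_norm ?subr_ge0.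
have W := weak_ramp y s's s't' k0 t'k.
have iBst := segment_integrableS s1 t0 iB.
rewrite ipBl -/(a t) -/(a s) (Rintegral_split (le_trans st' s't') t't iBst).
rewrite (Rintegral_split st' s't' (segment_integrableS (lexx s) t't iBst)).
have S0 := Rintegral_split s't' t'0 (segment_integrableS s'1 (lexx 0) iB).
rewrite S0 in Rs.
move: W Ds Dt Rs Rt I1 I2 a1 a2; rewrite !ler_norml; clear.
move=> ? /andP[? ?] /andP[? ?] /andP[? ?] /andP[? ?] /andP[? ?] /andP[? ?].
by move=> /andP[? ?] /andP[? ?]; apply/andP; split; lra.
Qed.

End weak_FTC.

(** * The energy identity *)

Section partition_sums.
Context {R : realType}.
Notation mu := (@lebesgue_measure R).
Notation D := (delay_itv : set (measurableTypeR R)).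

Lemma nondecreasing_measurable_itv (v : R -> R) :
  (forall s t : R, -1 <= s -> s <= t -> t <= 0 -> v s <= v t) ->
  measurable_fun D v.
Proof.
move=> v_nd.
apply: (@eq_measurable_fun _ _ _ _ _ (fun r : R => v (Num.max (-1) (Num.min r 0)))).
  move=> r; rewrite inE /delay_itv/= in_itv/= => /andP[r1 r0].
  by rewrite (min_idPl r0) (max_idPr r1).
apply: nondecreasing_measurable => // s t st; apply: v_nd.
- by rewrite le_max lexx.
- rewrite ge_max le_max lexx/= le_max; apply/orP; right.
  by rewrite le_min !ge_min st lexx orbT.
- by rewrite ge_max ge_min lexx orbT andbT lerN10.
Qed.

Lemma Rintegral_upt (g : R -> R) n : mu.-integrable D (EFin \o g) ->
  \int[mu]_(r in D) g r =
  \sum_(0 <= i < n.+1) \int[mu]_(r in `[upt n i, upt n i.+1]) g r.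
Proof.
move=> gi.
suff E j : (j <= n.+1)%N -> \int[mu]_(r in `[-1, upt n j]) g r =
    \sum_(0 <= i < j) \int[mu]_(r in `[upt n i, upt n i.+1]) g r.
  by rewrite -E// uptS.
elim: j => [|j IH] jn; first by rewrite upt0 set_itv1 Rintegral_set1 big_nil.
rewrite big_nat_recr//= -IH ?(ltnW jn)//; apply: Rintegral_split.
- exact: upt_ge.
- exact/ltW/upt_lt.
- exact: segment_integrableS (lexx _) (upt_le jn) gi.
Qed.

Lemma upt_step_small (d : R) : 0 < d ->
  \forall n \near \oo, forall i, upt n i.+1 - upt n i < d.
Proof.
move=> d0; near=> n; move=> i; rewrite upt_step; near: n.
exact: near_infty_natSinv_lt (PosNum d0).
Unshelve. all: by end_near. Qed.

(** Summation by parts with [v] taken on the right and [q] on the left, so that the second sum has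
    the left tags of the Stieltjes sums. *)
Lemma sum_abel (v q : nat -> R) n :
  \sum_(0 <= i < n) v i.+1 * (q i.+1 - q i) + \sum_(0 <= i < n) q i * (v i.+1 - v i)
  = v n * q n - v 0%N * q 0%N.
Proof.
rewrite -big_split/= -(telescope_sumr (fun i => v i * q i))//.
by apply: eq_bigr => i _; ring.
Qed.

End partition_sums.

Section energy.
Context {R : realType} {X : normedModType R} (ip : {dot X for idfun}).
Context (normE : forall x, `|x| = ip_norm ip x).
Notation mu := (@lebesgue_measure R).
Notation D := (delay_itv : set (measurableTypeR R)).
Context (F G : L2 X) (f : R -> X) (nu : R).
Context (FG : weak_derivative F G) (Ff : is_continuous_rep F f).
Context (v : R -> R) (v_ge0 : 0 <= v (-1)).
Context (v_nd : forall s t : R, -1 <= s -> s <= t -> t <= 0 -> v s <= v t).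
Implicit Types (s t c d e r : R).
Notation h := (damped f nu).
Notation L := (damped_deriv F G nu).
Notation wg := (wgt nu).
Notation E := (expR `|nu|).

Let sL : square_integrable L := damped_deriv_square_integrable F G nu.
Let g r := v r * (wg r * wg r) * ip (L r) (repr F r).

Let v0 r : -1 <= r -> r <= 0 -> 0 <= v r.
Proof. by move=> r1 r0; apply: le_trans v_ge0 (v_nd _ _ _). Qed.

Lemma weight_measurable : measurable_fun D (fun r => v r * (wg r * wg r)).
Proof.
apply: measurable_funM; first exact: nondecreasing_measurable_itv.
by apply: measurable_funM; exact: measurable_wgt.
Qed.

Lemma weight_bounded r : D r -> `|v r * (wg r * wg r)| <= v 0 * (E * E).
Proof.
move=> Dr; have := Dr; rewrite /delay_itv/= in_itv/= => /andP[r1 r0].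
rewrite 2!normrM !ler_pM ?wgt_le//.
by rewrite ger0_norm ?v0// v_nd.
Qed.

Lemma energy_integrable : mu.-integrable D (EFin \o g).
Proof.
exact: (integrable_wip normE weight_measurable weight_bounded sL
  (repr_square_integrable F)).
Qed.

(** The increment of [|h|^2] is the pairing of [h t - h s] with [h t + h s], and [weak_FTC] makes it
    an integral over [[s, t]]. The difference to be bounded is then the integral of [wg r] times the
    pairing of [L r] with [2 v(r) h(r) - v(t) (h(t) + h(s))]; this vector splits into a part
    controlled by the increment of [v] and a part controlled by the oscillation of [h]. *)
Lemma energy_step s t e M : -1 <= s -> s <= t -> t <= 0 ->
  (forall r, r \in `[-1, 0] -> `|h r| <= M) ->
  (forall r, r \in `[s, t] -> `|h r - h s| <= e /\ `|h r - h t| <= e) ->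
  `|2 * \int[mu]_(r in `[s, t]) g r - v t * (ip (h t) (h t) - ip (h s) (h s))| <=
  (2 * M * (v t - v s) + 2 * v 0 * e) * E * \int[mu]_(r in `[s, t]) `|L r|.
Proof.
move=> s1 st t0 hM he.
have ht : ip (h t) (h t) - ip (h s) (h s) = ip (h t - h s) (h t + h s).
  by move: (h t) (h s) => x y; rewrite !ip_linE (ip_sym ip y); ring.
rewrite ht (weak_FTC normE nu FG Ff _ s1 st t0).
have ig := segment_integrableS s1 t0 energy_integrable.
have iB := segment_integrableS s1 t0 (integrable_damped_deriv normE F G nu (h t + h s)).
have iL := segment_integrableS s1 t0 (square_integrable_norm sL).
rewrite -!RintegralZl// -RintegralB//; [|exact: integrable_mull..].
have vst : 0 <= v t - v s by rewrite subr_ge0 v_nd.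
have M0 : 0 <= M by apply: le_trans (hM 0 _) => //; rewrite in_itv/= lexx lerN10.
have e0 : 0 <= e.
  by have [] := he s; rewrite ?in_itv/= ?lexx// subrr normr0.
have v00 : 0 <= v 0 by apply: v0 => //; exact: lerN10.
have C0 : 0 <= (2 * M * (v t - v s) + 2 * v 0 * e) * E.
  by rewrite mulr_ge0 ?expR_ge0// addr_ge0// !mulr_ge0.
apply: le_normr_Rintegral_ae => //.
- by apply: integrable_sub => //; exact: integrable_mull.
- exact: integrable_mull.
- by move=> r _; rewrite mulr_ge0.
have := Ff.2; apply: filterS => r Fr rst.
have [r1 r0] : -1 <= r /\ r <= 0.
  move: rst; rewrite /= in_itv/= => /andP[sr rt].
  by rewrite (le_trans s1 sr) (le_trans rt t0).
have Dr : D r by rewrite /delay_itv/= in_itv/= r1 r0.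
have Fr' : repr F r = f r := Fr Dr.
have -> : 2 * g r - v t * (wg r * ip (L r) (h t + h s)) =
    wg r * ip (L r) ((2 * v r) *: h r - v t *: (h t + h s)).
  rewrite /g Fr' -[in LHS](mulrA (v r)) -(mulrA (wg r)) -(ipZr ip (wg r)).
  by rewrite ipBr !ipZr mulrBr; congr (_ - _); rewrite /h; ring.
rewrite normrM -[leRHS]mulrA [leRHS]mulrCA ler_pM ?wgt_le// [leRHS]mulrC.
apply: le_trans (cauchy_schwarz normE _ _) _; rewrite ler_wpM2l//.
have -> : (2 * v r) *: h r - v t *: (h t + h s) =
    (2 * (v r - v t)) *: h r + v t *: ((h r - h s) + (h r - h t)).
  have -> : (h r - h s) + (h r - h t) = 2 *: h r - (h t + h s).
    by rewrite addrACA -opprD [h s + _]addrC scaler_nat mulr2n.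
  move: (h r) (h t) (h s) => x y z.
  by rewrite scalerBr scalerA mulrBr scalerBl (mulrC (v t)) addrA subrK.
have [h1 h2] := he r rst.
have vr : `|v r - v t| <= v t - v s.
  move: rst; rewrite /= in_itv/= => /andP[sr rt].
  by rewrite distrC ger0_norm ?subr_ge0 ?v_nd// lerD2l lerN2 v_nd.
apply: le_trans (ler_normD _ _) _; apply: lerD.
  rewrite normrZ normrM (ger0_norm (x := 2))// mulrAC.
  by rewrite -!mulrA ler_wpM2l// ler_pM// hM// in_itv/= r1 r0.
rewrite normrZ (ger0_norm (v0 (le_trans s1 st) t0)) [leRHS]mulrAC mulrC.
apply: ler_pM => //; first exact: v0 (le_trans s1 st) t0.
  apply: le_trans (ler_normD _ _) _.
  by rewrite mulrDl mul1r lerD.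
by rewrite v_nd// (le_trans s1 st).
Qed.

(* Integration by parts of [2 \int v <h', h>] for a merely monotone [v]; the jumps
   of [v] are harmless because [\int |h'|] is small on short intervals. *)
Lemma energy_cvg :
  \sum_(0 <= i < n.+1)
    ip (h (upt n i)) (h (upt n i)) * (v (upt n i.+1) - v (upt n i)) @[n --> \oo]
  --> v 0 * ip (h 0) (h 0) - v (-1) * ip (h (-1)) (h (-1))
      - 2 * \int[mu]_(r in D) (v r * (wg r * wg r) * ip (L r) (repr F r)).
Proof.
apply/cvgrPdist_le => e e0.
have [M M0 hM] := segment_bounded (continuous_damped (nu := nu) Ff).
set N := \int[mu]_(r in D) `|L r|.
have N0 : 0 <= N by exact: Rintegral_ge0.
have v00 : 0 <= v 0 by apply: v0 => //; exact: lerN10.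
have vv : 0 <= v 0 - v (-1) by rewrite subr_ge0 v_nd// lerN10.
(* [C1] multiplies the oscillation of [h], which [d1] makes small. [C2] collects the increments of
   [v], which need not be small individually; there the small factor is the integral of [|L|], by
   [d2]. *)
set C1 := 2 * v 0 * E * N; set C2 := 2 * M * E * (v 0 - v (-1)).
have C10 : 0 <= C1 by rewrite !mulr_ge0 ?expR_ge0.
have C20 : 0 <= C2 by rewrite !mulr_ge0 ?expR_ge0.
have eta0 : 0 < e / 2 / (C1 + 1) by rewrite !divr_gt0// ltr_wpDl.
have m0 : 0 < e / 2 / (C2 + 1) by rewrite !divr_gt0// ltr_wpDl.
have [d1 d10 d1P] := segment_uniform_continuity (continuous_damped (nu := nu) Ff) eta0.
have [d2 d20 d2P] := Rintegral_norm_small sL m0.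
near=> n.
have st1 i : upt n i.+1 - upt n i < d1 by move: i; near: n; exact: upt_step_small.
have st2 i : upt n i.+1 - upt n i < d2 by move: i; near: n; exact: upt_step_small.
set q := fun r => ip (h r) (h r).
have := sum_abel (fun i => v (upt n i)) (fun i => q (upt n i)) n.+1.
rewrite uptS upt0 => abel.
rewrite -/(q 0) -/(q (-1)) -abel -/g addrAC addrK.
rewrite (Rintegral_upt n energy_integrable) mulr_sumr distrC -sumrB.
set I := fun i => \int[mu]_(r in `[upt n i, upt n i.+1]) `|L r|.
have NE : N = \sum_(0 <= i < n.+1) I i.
  exact: Rintegral_upt (square_integrable_norm sL).
apply: le_trans (ler_norm_sum _ _ _) _.
apply: (@le_trans _ _ (\sum_(0 <= i < n.+1)
    (2 * M * E * (e / 2 / (C2 + 1)) * (v (upt n i.+1) - v (upt n i)) +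
     2 * v 0 * E * (e / 2 / (C1 + 1)) * I i))).
  rewrite !big_nat; apply: ler_sum => i /andP[_ i_n].
  have i1 := @upt_ge R n i; have i0 := @upt_le R _ _ i_n.
  have ii := ltW (@upt_lt R n i).
  have step := energy_step i1 ii i0 hM (e := e / 2 / (C1 + 1)).
  apply: le_trans (step _) _.
    move=> r; rewrite in_itv/= => /andP[ir ri].
    have D1 : (upt n i : R) \in `[-1, 0] by rewrite in_itv/= i1 (le_trans ii).
    have D2 : (upt n i.+1 : R) \in `[-1, 0] by rewrite in_itv/= i0 (le_trans i1).
    have D3 : r \in `[-1, 0] by rewrite in_itv/= (le_trans i1)// (le_trans ri).
    split; apply/ltW/d1P => //.
      by rewrite ger0_norm ?subr_ge0// (le_lt_trans _ (st1 i))// lerD2r.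
    by rewrite distrC ger0_norm ?subr_ge0// (le_lt_trans _ (st1 i))// lerD2l lerN2.
  rewrite -/(I i); set dv := v _ - v _; set m := e / 2 / (C2 + 1).
  have vi : 0 <= dv by rewrite subr_ge0 v_nd.
  have -> : (2 * M * dv + 2 * v 0 * (e / 2 / (C1 + 1))) * E * I i =
    2 * M * E * dv * I i + 2 * v 0 * E * (e / 2 / (C1 + 1)) * I i by ring.
  rewrite lerD2r (mulrAC _ m) ler_wpM2l ?mulr_ge0 ?expR_ge0//.
  exact/ltW/d2P.
rewrite big_split/= -!mulr_sumr -NE.
rewrite (telescope_sumr (fun i => v (upt n i)))// uptS upt0.
rewrite [leRHS](splitr e); apply: lerD.
- have -> : 2 * M * E * (e / 2 / (C2 + 1)) * (v 0 - v (-1)) =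
    e / 2 * (C2 / (C2 + 1)) by rewrite /C2; ring.
  by rewrite ler_piMr ?divr_ge0 ?(ltW e0)// ler_pdivrMr ?ltr_wpDl// mul1r lerDl.
- have -> : 2 * v 0 * E * (e / 2 / (C1 + 1)) * N =
    e / 2 * (C1 / (C1 + 1)) by rewrite /C1; ring.
  by rewrite ler_piMr ?divr_ge0 ?(ltW e0)// ler_pdivrMr ?ltr_wpDl// mul1r lerDl.
Unshelve. all: by end_near. Qed.

End energy.

(** * The weighted inner product *)

Section dot_of_form.
Context {R : realType} {V : lmodType R} (B : V -> V -> R).
Context (B_lin : forall a u v z, B (a *: u + v) z = a * B u z + B v z).
Context (B_sym : forall u v, B u v = B v u).
Context (B_pos : forall u, u != 0 -> 0 < B u u).

Let B0 z : B 0 z = 0.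
Proof. by have := B_lin (-1) 0 0 z; rewrite scaler0 addr0 mulN1r addNr. Qed.

Let Bzl z : zmod_morphism (B ^~ z).
Proof.
move=> u v; have := B_lin (-1) v u z.
by rewrite scaleN1r mulN1r addrC => ->; rewrite addrC.
Qed.

Let Bzr z : zmod_morphism (B z).
Proof. by move=> u v; rewrite !(B_sym z) Bzl. Qed.

Let Bsl z : scalable_for *%R (B ^~ z).
Proof. by move=> a u; have := B_lin a u 0 z; rewrite addr0 B0 addr0. Qed.

Let Bsr z : scalable_for (idfun \; *%R) (B z).
Proof. by move=> a u; rewrite !(B_sym z) Bsl. Qed.

HB.instance Definition _ := @isBilinear.Build R V V R *%R (idfun \; *%R) B
  Bzl Bzr Bsl Bsr.

Let Bherm u v : B u v = (-1) ^+ false * idfun (B v u).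
Proof. by rewrite expr0 mul1r B_sym. Qed.

HB.instance Definition _ := @isHermitianSesquilinear.Build R V false idfun B Bherm.
HB.instance Definition _ := @isDotProduct.Build R V B B_pos.

(** The existential carries the structures declared on the local [B] out of the section. *)
Lemma dot_of_form : exists ip : {dot V for idfun}, forall u v, ip u v = B u v.
Proof. by exists (B : {dot V for idfun}). Qed.

End dot_of_form.

(** * Representatives of classes in L2 *)

Section L2_repr.
Local Open Scope quotient_scope.
Context {R : realType} {X : normedModType R}.
Notation mu := (@lebesgue_measure R).
Notation D := (delay_itv : set (measurableTypeR R)).

Lemma L2_eqP (f g : L2fun X) :
  (\pi_(L2 X) f = \pi_(L2 X) g) <-> ae_eq mu D f g.
Proof.
split=> [/eqP|fg].
  rewrite -Quotient.idealrBE inE; apply: filterS => t ft Dt.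
  by have := ft Dt; move/eqP; rewrite subr_eq0 => /eqP.
apply/eqP; rewrite -Quotient.idealrBE inE; move: fg; apply: filterS => t ft Dt.
have := ft Dt => e; transitivity (f t - g t) => //.
by rewrite e subrr.
Qed.

Lemma repr_pi_ae (f : L2fun X) : ae_eq mu D (repr (\pi_(L2 X) f)) f.
Proof. by apply/L2_eqP; rewrite reprK. Qed.

(** Representatives are chosen arbitrarily, so [repr] respects linear combinations only almost
    everywhere. *)
Lemma repr_linear_ae a (F H : L2 X) :
  ae_eq mu D (repr (a *: F + H)) (fun t => a *: repr F t + repr H t).
Proof.
have -> : a *: F + H = \pi_(L2 X) (a *: repr F + repr H).
  by rewrite pi_L2D -pi_L2scale !reprK.
exact: repr_pi_ae.
Qed.

Lemma repr_neq0 (F : L2 X) : F != 0 -> ~ ae_eq mu D (repr F) (cst 0).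
Proof.
move=> F0 h; case/eqP: F0; rewrite -[F]reprK.
have -> : (0 : L2 X) = \pi_(L2 X) (0 : L2fun X).
  by apply/esym/(@addrI _ (\pi_(L2 X) 0)); rewrite -pi_L2D !addr0.
exact/L2_eqP.
Qed.

End L2_repr.

Section weighted_ip.
Context {R : realType} {X : normedModType R} (ip : {dot X for idfun}).
Context (normE : forall x, `|x| = ip_norm ip x).
Notation mu := (@lebesgue_measure R).
Notation D := (delay_itv : set (measurableTypeR R)).
Context (w : R -> R) (c C : R) (c0 : 0 < c).
Context (mw : measurable_fun D w) (w_itv : forall t, D t -> c <= w t <= C).
Implicit Types (F G H : L2 X) (a : R).

Definition weighted_ip (u v : X * L2 X) : R :=
  ip u.1 v.1 + \int[mu]_(t in D) (w t * ip (repr u.2 t) (repr v.2 t)).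

Let w_bounded t : D t -> `|w t| <= C.
Proof.
by move=> /w_itv /andP[cw wC]; rewrite ger0_norm// (le_trans (ltW c0)).
Qed.

Lemma weighted_integrable F G :
  mu.-integrable D (EFin \o (fun t => w t * ip (repr F t) (repr G t))).
Proof.
by apply: (integrable_wip normE mw w_bounded); exact: repr_square_integrable.
Qed.

Lemma weighted_L2_linear a F G H :
  \int[mu]_(t in D) (w t * ip (repr (a *: F + G) t) (repr H t)) =
  a * \int[mu]_(t in D) (w t * ip (repr F t) (repr H t))
  + \int[mu]_(t in D) (w t * ip (repr G t) (repr H t)).
Proof.
have iF := weighted_integrable F H; have iG := weighted_integrable G H.
have iaF := integrable_mull a measurable_delay_itv iF.
rewrite -RintegralZl// -RintegralD//; apply: eq_Rintegral_ae => //.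
- by apply/measurable_EFinP; exact: measurable_int (weighted_integrable _ _).
- by apply/measurable_EFinP; exact: measurable_int (integrable_add _ iaF iG).
- have := repr_linear_ae a F G; apply: filterS => t tE Dt.
  by rewrite (tE Dt) ipDl ipZl; ring.
Qed.

Let L2_sqr F := \int[mu]_(t in D) (`|repr F t| ^+ 2).

Lemma weighted_sqr_itv F :
  c * L2_sqr F <= \int[mu]_(t in D) (w t * ip (repr F t) (repr F t)) <= C * L2_sqr F.
Proof.
have iF := weighted_integrable F F.
have i2 := square_integrable_sqr (repr_square_integrable F).
rewrite -!RintegralZl//; apply/andP; split; apply: le_Rintegral => //.
- exact: integrable_mull.
- move=> t /w_itv /andP[cw _].
  by rewrite (ip_sqr normE) ler_wpM2r ?sqr_ge0.
- exact: integrable_mull.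
- move=> t /w_itv /andP[_ wC].
  by rewrite (ip_sqr normE) ler_wpM2r ?sqr_ge0.
Qed.

Lemma L2_sqr_ge0 F : 0 <= L2_sqr F.
Proof. by apply: Rintegral_ge0 => t _; exact: sqr_ge0. Qed.

Lemma L2_sqr_eq0 F : L2_sqr F = 0 -> F = 0.
Proof.
move=> F0; apply/eqP; apply: contrapT => /negP /repr_neq0; apply.
have i2 := square_integrable_sqr (repr_square_integrable F).
set g := fun t => `|repr F t| ^+ 2 in i2.
have m2 := measurable_int _ i2.
have /(ae_eq_integral_abs mu measurable_delay_itv m2) :
    (\int[mu]_(t in D) `|(EFin \o g) t| = 0)%E.
  under eq_integral do rewrite /= ger0_norm ?sqr_ge0//.
  have fin := integrable_fin_num measurable_delay_itv i2.
  by rewrite -(fineK fin); congr EFin.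
apply: filterS => t h Dt; have := h Dt; move=> [] /eqP.
by rewrite expf_eq0/= normr_eq0 => /eqP.
Qed.

Lemma exists_weighted_dot : exists ip' : {dot (X * L2 X)%type for idfun},
  (forall u v, ip' u v = weighted_ip u v) /\ equivalent_ip (canonical_ip ip) ip'.
Proof.
have [|||ip' ip'E] := @dot_of_form R (X * L2 X)%type weighted_ip.
- move=> a u v z; rewrite /weighted_ip /= weighted_L2_linear ipDl ipZl mulrDr.
  by rewrite addrACA.
- move=> u v; rewrite /weighted_ip ip_sym; congr (_ + _).
  by apply: eq_Rintegral => t _; rewrite ip_sym.
- move=> [x F] u0; rewrite /weighted_ip /=.
  have /andP[cF _] := weighted_sqr_itv F.
  have cF0 : 0 <= c * L2_sqr F by rewrite mulr_ge0 ?(ltW c0)// L2_sqr_ge0.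
  have [x0|x0] := eqVneq x 0; last first.
    by rewrite ltr_pwDl// ?neq0_dnorm_gt0// (le_trans cF0).
  rewrite x0 linear0l add0r; apply: lt_le_trans cF.
  rewrite mulr_gt0// lt_neqAle L2_sqr_ge0 andbT eq_sym.
  by apply/eqP => /L2_sqr_eq0 F0; move: u0; rewrite x0 F0 eqxx.
exists ip'; split => //.
have wC0 : 0 < C.
  have /w_itv/andP[cw wC] : D 0 by rewrite /delay_itv/= in_itv/= lexx lerN10.
  exact: lt_le_trans c0 (le_trans cw wC).
(* The component in [X] keeps the weight 1, hence the comparison of [c] and [C] with 1. *)
exists (Num.sqrt (Num.min 1 c)), (Num.sqrt (Num.max 1 C)).
rewrite !sqrtr_gt0 lt_min lt_max ltr01 c0 wC0; split => // -[x F].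
rewrite /ip_norm ip'E /canonical_ip /weighted_ip /L2_ip/=.
have FE : \int[mu]_(t in D) ip (repr F t) (repr F t) = L2_sqr F.
  by apply: eq_Rintegral => t _; rewrite (ip_sqr normE).
rewrite FE; have /andP[cF CF] := weighted_sqr_itv F.
have x0 := ip_ge0 ip x; have F0 := L2_sqr_ge0 F.
rewrite -!sqrtrM ?le_min ?ler01 ?(ltW c0) ?le_max ?ler01//; apply/andP; split.
- apply: ler_wsqrtr; rewrite mulrDr; apply: lerD.
    by rewrite ler_piMl// ge_min lexx.
  by apply: le_trans cF; rewrite ler_wpM2r// ge_min lexx orbT.
- apply: ler_wsqrtr; rewrite mulrDr; apply: lerD.
    by rewrite ler_peMl// le_max lexx.
  by apply: le_trans CF _; rewrite ler_wpM2r// le_max lexx orbT.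
Qed.

End weighted_ip.

(** * Dissipativity *)

(* [k = (V + eta) / c] makes [V / k < c], and [k * E < c] once [(V + eta) * E < c ^ 2]. *)
Lemma exists_balance (R : realType) (c V E : R) : 0 <= V -> 0 <= E ->
  Num.sqrt (V * E) < c ->
  exists k eps, [/\ 0 < k, 0 < eps & V / k + (eps + k * E) <= 2 * c].
Proof.
move=> V0 E0 sVE; have c0 : 0 < c by apply: le_lt_trans sVE; exact: sqrtr_ge0.
have VE : V * E < c ^+ 2.
  rewrite -(sqr_sqrtr (mulr_ge0 V0 E0)).
  by rewrite ltr_pXn2r// nnegrE ?sqrtr_ge0// ltW.
have E1 : 0 < E + 1 by rewrite ltr_wpDl.
(* Dividing by [E + 1] gives [eta * E < c ^+ 2 - V * E] even when [E = 0]. *)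
pose eta := (c ^+ 2 - V * E) / (E + 1).
have eta0 : 0 < eta by rewrite divr_gt0// subr_gt0.
have Ve : 0 < V + eta by rewrite ltr_wpDl.
pose k := (V + eta) / c; have k0 : 0 < k by rewrite divr_gt0.
have Vk : V / k < c.
  rewrite /k invf_div mulrCA gtr_pMr// ltr_pdivrMr// mul1r.
  by rewrite ltrDl.
have kE : k * E < c.
  rewrite /k mulrAC ltr_pdivrMr// mulrDl -expr2 -ltrBrDl /eta.
  rewrite mulrAC -mulrA gtr_pMr ?subr_gt0// ltr_pdivrMr// mul1r.
  by rewrite ltrDl.
exists k, (2 * c - V / k - k * E); split => //.
  by move: Vk kE; clear; lra.
by rewrite subrK addrC subrK.
Qed.

Section delay_generator_dissipative.
Context {R : realType} {X : normedModType R} (ip : {dot X for idfun}).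
Context (normE : forall x, `|x| = ip_norm ip x).
Notation mu := (@lebesgue_measure R).
Notation D := (delay_itv : set (measurableTypeR R)).
Context (DB : set X) (B : X -> X) (zeta : R -> X -> X).
Context (zeta_bounded : forall t, delay_itv t -> bounded_operator (zeta t)).
Context (zeta_BV : op_bounded_variation zeta (-1) 0).
Notation V := (total_var zeta).

(** If the values at 0 differed, continuity would separate [f] and [g] on some [[p, 0]], of positive
    length, against their equality almost everywhere. It identifies the boundary value in the domain
    with that of [continuous_rep F]. *)
Lemma continuous_rep_right (F : L2 X) f g : is_continuous_rep F f ->
  is_continuous_rep F g -> f 0 = g 0.
Proof.
move=> [cf Ff] [cg Fg]; apply/eqP; rewrite -subr_eq0 -normr_le0 leNgt.
apply/negP => fg0; have e0 : 0 < `|f 0 - g 0| / 2 by rewrite divr_gt0.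
have [d1 d10 d1P] := segment_uniform_continuity cf e0.
have [d2 d20 d2P] := segment_uniform_continuity cg e0.
pose p : R := - (Num.min 1 (Num.min d1 d2) / 2).
have pm : - p < Num.min 1 (Num.min d1 d2).
  by rewrite opprK ltr_pdivrMr// ltr_pMr ?ltr1n// !lt_min ltr01 d10 d20.
have p0 : p < 0 by rewrite oppr_lt0 divr_gt0// !lt_min ltr01 d10 d20.
move: pm; rewrite !lt_min => /and3P[p1 pd1 pd2].
have p1' : -1 <= p by rewrite lerNl ltW.
have cst_i (k : R) : mu.-integrable `[p, 0] (EFin \o cst k).
  by apply: (segment_bounded_integrable (M := `|k|)).
(* Equality of [f] and [g] at a point of [[p, 0]] is absurd, so [1 <= 0] holds almost everywhere
   there; integrating it yields [- p <= 0]. *)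
have : `|\int[mu]_(r in `[p, 0]) (1 : R)| <= \int[mu]_(r in `[p, 0]) (0 : R).
  apply: le_normr_Rintegral_ae => //; [exact: cst_i|exact: cst_i|].
  have : ae_eq mu D f g by apply: ae_eq_trans Fg; exact: ae_eq_sym.
  apply: filterS => r fgr; rewrite /= in_itv/= => /andP[pr r0].
  have Dr : r \in `[-1, 0] by rewrite in_itv/= (le_trans p1' pr).
  have D0 : (0 : R) \in `[-1, 0] by rewrite in_itv/= lexx lerN10.
  have fgE : f r = g r := fgr Dr.
  have rp : `|0 - r| <= - p by rewrite sub0r normrN ler0_norm// lerN2.
  have h1 := d1P _ _ D0 Dr (le_lt_trans rp pd1).
  have h2 := d2P _ _ D0 Dr (le_lt_trans rp pd2).
  suff : `|f 0 - g 0| < `|f 0 - g 0| by rewrite ltxx.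
  rewrite -{1}(subrKA (f r)) (le_lt_trans (ler_normD _ _))//.
  by rewrite [ltRHS](splitr `|f 0 - g 0|) ltrD// fgE distrC.
rewrite !Rintegral_cst// mul0r mul1r mu_segment ?(ltW p0)// sub0r normrN.
by rewrite normr_le0 lt_eqF.
Qed.

Lemma continuous_repP (F : L2 X) f : is_continuous_rep F f ->
  is_continuous_rep F (continuous_rep F).
Proof. by move=> Ff; exact: (xgetPex (cst 0) (ex_intro _ f Ff)). Qed.

Lemma total_var_step n i (x y : X) : (i < n.+1)%N ->
  `|ip (zeta (upt n i.+1) x - zeta (upt n i) x) y| <=
  (V (upt n i.+1) - V (upt n i)) * (`|x| * `|y|).
Proof.
move=> i_n; have i1 := @upt_ge R n i; have i2 := @upt_le R _ _ i_n.
have ii := @upt_lt R n i.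
apply: le_trans (cauchy_schwarz normE _ _) _; rewrite mulrA ler_wpM2r//.
have Di j : (j <= n.+1)%N -> delay_itv (upt n j : R).
  by move=> jn; rewrite /delay_itv/= in_itv/= upt_ge upt_le.
have bz := bounded_operatorB (zeta_bounded (Di _ i_n)) (zeta_bounded (Di _ (ltnW i_n))).
apply: le_trans (ler_opnorm x bz) _; rewrite ler_wpM2r// lerBrDl.
exact: total_var_opnorm.
Qed.

(* Holds even when the Stieltjes sums do not converge: then the integral is 0. *)
Lemma delay_integral_bound f (x : X) k : 0 < k -> forall e, 0 < e ->
  \forall n \near \oo, 2 * ip (RS_integral zeta f (-1) 0) x <=
    (V 0 - V (-1)) / k * `|x| ^+ 2 +
    k * (\sum_(0 <= i < n.+1)
          `|f (upt n i)| ^+ 2 * (V (upt n i.+1) - V (upt n i))) + e.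
Proof.
move=> k0 e e0; pose S n := \sum_(0 <= i < n.+1)
  `|f (upt n i)| ^+ 2 * (V (upt n i.+1) - V (upt n i)).
have VS n i : (i < n.+1)%N -> 0 <= V (upt n i.+1) - V (upt n i).
  move=> i_n; rewrite subr_ge0 total_var_nondecreasing ?upt_ge ?upt_le//.
  exact/ltW/upt_lt.
have V0 : 0 <= V 0 - V (-1).
  by rewrite subr_ge0 total_var_nondecreasing// lerN10.
have S0 n : 0 <= S n.
  rewrite /S big_nat; apply: sumr_ge0 => i /andP[_ i_n].
  by rewrite mulr_ge0 ?sqr_ge0 ?VS.
have [[v vP]|nov] := pselect (exists v, is_RS_integral zeta f (-1) 0 v); last first.
  have -> : RS_integral zeta f (-1) 0 = 0.
    by apply: xgetPN => v vP; apply: nov; exists v.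
  near=> n; rewrite linear0l mulr0 addr_ge0 ?(ltW e0)// addr_ge0//.
    by rewrite mulr_ge0 ?sqr_ge0// divr_ge0// ltW.
  by apply: mulr_ge0; [exact: ltW|exact: S0].
have := xgetPex 0 (ex_intro _ v vP).
rewrite -/(RS_integral zeta f (-1) 0) => /RS_integral_uniform.
set P := RS_integral _ _ _ _; move/cvgrPdist_lt => cP.
have e1 : 0 < e / (2 * (`|x| + 1)) by rewrite divr_gt0// mulr_gt0// ltr_wpDl.
have := cP _ e1; apply: filterS => n; set Q := \sum_(0 <= i < _) _ => PQ.
have PQx : ip P x - ip Q x <= e / 2.
  rewrite -ipBl (le_trans (ler_norm _))// (le_trans (cauchy_schwarz normE _ _))//.
  apply: (@le_trans _ _ (e / (2 * (`|x| + 1)) * `|x|)).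
    by rewrite ler_wpM2r// ltW.
  have -> : e / (2 * (`|x| + 1)) * `|x| = e / 2 * (`|x| / (`|x| + 1)).
    by field; rewrite gt_eqF// ltr_wpDl.
  by rewrite ler_piMr ?divr_ge0 ?(ltW e0)// ler_pdivrMr ?ltr_wpDl// mul1r lerDl.
have Qx : 2 * ip Q x <= (V 0 - V (-1)) / k * `|x| ^+ 2 + k * S n.
  rewrite /Q ip_suml mulr_sumr.
  apply: (@le_trans _ _ (\sum_(0 <= i < n.+1) (
      (`|x| ^+ 2 / k) * (V (upt n i.+1) - V (upt n i)) +
      k * (`|f (upt n i)| ^+ 2 * (V (upt n i.+1) - V (upt n i)))))).
    rewrite !big_nat; apply: ler_sum => i /andP[_ i_n].
    have := total_var_step (f (upt n i)) x i_n; have := VS n i i_n.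
    set dV := V _ - V _ => dV0 h.
    apply: (@le_trans _ _ (2 * (dV * (`|f (upt n i)| * `|x|)))).
      by rewrite ler_wpM2l// (le_trans (ler_norm _)).
    have -> : `|x| ^+ 2 / k * dV + k * (`|f (upt n i)| ^+ 2 * dV) =
      dV * (`|x| ^+ 2 / k + k * `|f (upt n i)| ^+ 2) by ring.
    rewrite mulrCA ler_wpM2l// -(ler_pM2l k0) mulrDr (mulrC k (_ / k)) divfK ?gt_eqF//.
    have := sqr_ge0 (`|x| - k * `|f (upt n i)|).
    by move: `|x| `|f (upt n i)| => a b {h}; nra.
  rewrite big_split/= -!mulr_sumr (telescope_sumr (fun i => V (upt n i)))//.
  by rewrite uptS upt0 mulrAC (mulrC (`|x| ^+ 2)) mulrAC.
by rewrite -/(S n); move: PQx Qx; clear; lra.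
Unshelve. all: by end_near. Qed.

Let V_nd (s t : R) : -1 <= s -> s <= t -> t <= 0 -> V s <= V t.
Proof. exact: total_var_nondecreasing. Qed.

Lemma delay_generator_dissipative (lambda nu m : R) : nu <= m ->
  dissipative ip DB (fun x => B x - lambda *: x) ->
  lambda + Num.sqrt ((V 0 - V (-1)) *
    RS_integral_scalar V (fun r => expR (2 * nu * r)) (-1) 0) < m ->
  exists ip' : {dot (X * L2 X)%type for idfun},
    equivalent_ip (canonical_ip ip) ip' /\
    dissipative ip' (delay_generator_domain DB)
      (fun u => delay_generator B zeta u - m *: u).
Proof.
move=> nu_m B_diss; rewrite (RS_integral_exp V_nd) -ltrBrDl.
set Q := exp_stieltjes V (2 * nu) => hm.
have Q_nd (s t : R) : -1 <= s -> s <= t -> t <= 0 -> Q s <= Q t.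
  exact: exp_stieltjes_nondecreasing.
have V0 : 0 <= V 0 - V (-1) by rewrite subr_ge0 V_nd// lerN10.
have Q0 : 0 <= Q 0 - Q (-1) by rewrite subr_ge0 Q_nd// lerN10.
have [k [eps [k0 eps0 keps]]] := exists_balance V0 Q0 hm.
pose v r := eps + k * (Q r - Q (-1)).
have v1 : v (-1) = eps by rewrite /v subrr mulr0 addr0.
have v_ge0 : 0 <= v (-1) by rewrite v1 ltW.
have v_nd (s t : R) : -1 <= s -> s <= t -> t <= 0 -> v s <= v t.
  by move=> s1 st t0; rewrite lerD2l ler_wpM2l ?(ltW k0)// lerD2r Q_nd.
pose w r := v r * (wgt nu r * wgt nu r).
(* The term [eps] keeps [w] away from 0, as the equivalence of norms requires; the exponentials are
   bounded on both sides over [[-1, 0]]. *)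
have w_itv t : D t -> eps * (expR (- `|nu|) * expR (- `|nu|)) <= w t <=
    v 0 * (expR `|nu| * expR `|nu|).
  move=> Dt; rewrite (le_trans (ler_norm _) (weight_bounded _ v_ge0 v_nd Dt)) andbT.
  have := Dt; rewrite /delay_itv/= in_itv/= => /andP[t1 t0].
  have wl : expR (- `|nu|) <= wgt nu t.
    rewrite /wgt ler_expR mulNr lerN2 (le_trans (ler_norm _))// normrM.
    by rewrite ler_piMr// ler_norml t1 (le_trans t0).
  rewrite ler_pM ?mulr_ge0 ?expR_ge0 ?(ltW eps0)//.
    by rewrite -v1 v_nd.
  by rewrite ler_pM ?expR_ge0.
have ceps : 0 < eps * (expR (- `|nu|) * expR (- `|nu|)).
  by rewrite !mulr_gt0 ?expR_gt0.
have mw := weight_measurable nu v_nd.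
have [ip' [ip'E ip'eq]] := exists_weighted_dot normE ceps mw w_itv.
exists ip'; split => // -[x F] /= [/= DBx [G0 FG0] [f0 Ff0 f00]].
rewrite ip'E /weighted_ip /=.
set G := wderiv F; have FG : weak_derivative F G.
  exact: (xgetPex 0 (ex_intro _ G0 FG0)).
set f := continuous_rep F; have Ff : is_continuous_rep F f := continuous_repP Ff0.
have fx : f 0 = x by rewrite (continuous_rep_right Ff Ff0).
rewrite /delay_op -/f; set Phi := RS_integral zeta f (-1) 0.
set I := \int[mu]_(r in D) (w r * ip (damped_deriv F G nu r) (repr F r)).
(* Replacing [m] by [nu] adds [m - nu] times the integral of [w |F|^2], nonnegative because
   [nu <= m]. *)
have IL : \int[mu]_(t in D) (w t * ip (repr (G - m *: F) t) (repr F t)) <= I.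
  have iF := weighted_integrable normE ceps mw w_itv F F.
  have iG := weighted_integrable normE ceps mw w_itv G F.
  have -> : G - m *: F = (- m) *: F + G by rewrite scaleNr addrC.
  rewrite (weighted_L2_linear normE ceps mw w_itv).
  have -> : I = \int[mu]_(t in D) (w t * ip (repr G t) (repr F t)) -
      nu * \int[mu]_(t in D) (w t * ip (repr F t) (repr F t)).
    rewrite -RintegralZl// -RintegralB//; last exact: integrable_mull.
    by apply: eq_Rintegral => t _; rewrite ipBl ipZl; ring.
  rewrite addrC mulNr lerD2l lerN2 ler_wpM2r// Rintegral_ge0// => t Dt.
  by have /andP[wt _] := w_itv t Dt; rewrite mulr_ge0 ?ip_ge0// (le_trans (ltW ceps)).
(* The three errors of size [e / 3] come from the Stieltjes sums of [Phi], from the energy identity,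
   and from comparing [k] times the increments of [V] with the increments of [v]. *)
have main : 2 * ip Phi x + 2 * I <= 2 * (m - lambda) * `|x| ^+ 2.
  apply/ler_addgt0Pr => e e0; have e3 : 0 < e / 3 by rewrite divr_gt0.
  have [M M0 hM] := segment_bounded (continuous_damped (nu := nu) Ff).
  set h := damped f nu in hM.
  pose K := 2 * (`|2 * nu| * expR `|2 * nu|).
  have K0 : 0 <= K by rewrite !mulr_ge0 ?expR_ge0.
  pose C := k * M ^+ 2 * K * (V 0 - V (-1)).
  have C0 : 0 <= C by rewrite !mulr_ge0 ?sqr_ge0 ?(ltW k0).
  have d0 : 0 < e / 3 / (C + 1) by rewrite divr_gt0// ltr_wpDl.
  have /cvgrPdist_le/(_ _ e3) energy := energy_cvg normE (nu := nu) FG Ff v_ge0 v_nd.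
  have step := upt_step_small d0.
  have bound := delay_integral_bound f x k0 e3.
  near \oo => n.
  have bound_n : 2 * ip Phi x <= (V 0 - V (-1)) / k * `|x| ^+ 2 +
      k * (\sum_(0 <= i < n.+1)
        `|f (upt n i)| ^+ 2 * (V (upt n i.+1) - V (upt n i))) + e / 3.
    by near: n; exact: bound.
  have step_n i : upt n i.+1 - upt n i < e / 3 / (C + 1).
    by move: i; near: n; exact: step.
  have energy_n : `|v 0 * ip (h 0) (h 0) - v (-1) * ip (h (-1)) (h (-1)) - 2 * I -
      \sum_(0 <= i < n.+1)
        ip (h (upt n i)) (h (upt n i)) * (v (upt n i.+1) - v (upt n i))| <= e / 3.
    by near: n; exact: energy.
  (* Since [|f|^2 = expR (2 * nu * r) * |h|^2], this is [exp_stieltjes_local] at left tags: on each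
     piece the increment of [Q] falls short of [expR (2 * nu * r)] times that of [V] by at most [K]
     times the mesh times the increment of [V]. [C] bounds the total shortfall per unit of mesh. *)
  have sums : k * (\sum_(0 <= i < n.+1)
        `|f (upt n i)| ^+ 2 * (V (upt n i.+1) - V (upt n i))) <=
      \sum_(0 <= i < n.+1)
        ip (h (upt n i)) (h (upt n i)) * (v (upt n i.+1) - v (upt n i)) + e / 3.
    apply: (@le_trans _ _ (\sum_(0 <= i < n.+1)
       (ip (h (upt n i)) (h (upt n i)) * (v (upt n i.+1) - v (upt n i)) +
        k * M ^+ 2 * K * (e / 3 / (C + 1)) * (V (upt n i.+1) - V (upt n i))))).
      rewrite mulr_sumr !big_nat; apply: ler_sum => i /andP[_ i_n].
      have i1 := @upt_ge R n i; have i2 := @upt_le R _ _ i_n.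
      have ii := ltW (@upt_lt R n i).
      have dV0 : 0 <= V (upt n i.+1) - V (upt n i) by rewrite subr_ge0 V_nd.
      have := exp_stieltjes_local V_nd (2 * nu) i1 (lexx _) ii i2.
      rewrite -/Q -/K ler_norml => /andP[Ql _].
      have hM2 : ip (h (upt n i)) (h (upt n i)) <= M ^+ 2.
        rewrite (ip_sqr normE) ler_pXn2r ?nnegrE// hM// in_itv/= i1.
        exact: le_trans ii i2.
      have h0 := ip_ge0 ip (h (upt n i)).
      have -> : `|f (upt n i)| ^+ 2 =
          ip (h (upt n i)) (h (upt n i)) * expR (2 * nu * upt n i).
        have w1 : wgt nu (upt n i) * wgt nu (upt n i) * expR (2 * nu * upt n i) = 1.
          by rewrite /wgt -!expRD (_ : _ + _ = 0) ?expR0//; ring.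
        rewrite -[LHS]mulr1 -[X in _ * X = _]w1 /h /damped ipZl ipZr (ip_sqr normE).
        by ring.
      have -> : v (upt n i.+1) - v (upt n i) = k * (Q (upt n i.+1) - Q (upt n i)).
        by rewrite /v; ring.
      move: (step_n i) Ql hM2 h0 dV0.
      set dV := V _ - V _; set dQ := Q _ - Q _; set ex := expR _.
      set hh := ip _ _; set dt := upt _ _ - _; set d := e / 3 / (C + 1).
      move=> dtd Ql hM2 h0 dV0.
      have t0 : 0 <= dt by rewrite subr_ge0.
      rewrite -subr_ge0.
      (* The gap is written as a combination of nonnegative factors: the local estimate,
         [M ^+ 2 - hh] and [d - dt]. *)
      have -> : hh * (k * dQ) + k * M ^+ 2 * K * d * dV - k * (hh * ex * dV) =
         k * (hh * (dQ - ex * dV + K * dt * dV) +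
              K * dV * ((M ^+ 2 - hh) * d + hh * (d - dt))) by ring.
      have d0' : 0 <= d by exact: ltW.
      apply: mulr_ge0; first exact: ltW.
      apply: addr_ge0.
        by apply: mulr_ge0 => //; rewrite -lerBlDr sub0r.
      apply: mulr_ge0; first exact: mulr_ge0.
      by apply: addr_ge0; apply: mulr_ge0; rewrite ?subr_ge0// ltW.
    rewrite big_split/= -mulr_sumr (telescope_sumr (fun i => V (upt n i)))//.
    rewrite uptS upt0 lerD2l.
    have -> : k * M ^+ 2 * K * (e / 3 / (C + 1)) * (V 0 - V (-1)) =
      e / 3 * (C / (C + 1)) by rewrite /C; ring.
    by rewrite ler_piMr ?(ltW e3)// ler_pdivrMr ?ltr_wpDl// mul1r lerDl.
  have h0E : ip (h 0) (h 0) = `|x| ^+ 2.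
    by rewrite /h /damped /wgt mulr0 expR0 scale1r fx (ip_sqr normE).
  (* The boundary term at -1 has the favourable sign and is dropped. *)
  have hm1 : 0 <= v (-1) * ip (h (-1)) (h (-1)) by rewrite mulr_ge0 ?ip_ge0.
  have xk := ler_wpM2r (sqr_ge0 `|x|) keps.
  have v0E : v 0 = eps + k * (Q 0 - Q (-1)) by [].
  move: energy_n; rewrite ler_norml h0E v0E => /andP[energy_n _].
  rewrite mulrDl in xk.
  move: bound_n sums energy_n hm1 xk.
  move: (\sum_(0 <= i < n.+1) _) (\sum_(0 <= i < n.+1) _) => S1 S2.
  move: ((eps + _) * _) (_ / k * _) (v (-1) * _) (_ * (m - lambda) * _) => *.
  by lra.
have := B_diss x DBx.
rewrite !ip_linE (ip_sqr normE).
move: main IL; move: (\int[mu]_(_ in D) _) => T.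
by move=> *; lra.
Unshelve. all: by end_near. Qed.

End delay_generator_dissipative.

Theorem corollary3p5 (R : realType) (X : completeNormedModType R)
    (ip : {dot X for idfun}) (normE : forall x : X, `|x| = ip_norm ip x)
    (DB : set X) (B : X -> X) (B_generator : generates_C0semigroup DB B)
    (zeta : R -> X -> X)
    (zeta_bounded : forall t, delay_itv t -> bounded_operator (zeta t))
    (zeta_BV : op_bounded_variation zeta (-1) 0)
    (lambda : R)
    (B_dissipative : dissipative ip DB (fun x => B x - lambda *: x)) :
  (forall mu : R,
     lambda + Num.sqrt ((total_var zeta 0 - total_var zeta (-1)) *
       RS_integral_scalar (total_var zeta) (fun r => expR (2 * lambda * r))
         (-1) 0) < mu ->
     exists ip' : {dot (X * L2 X)%type for idfun},
       equivalent_ip (canonical_ip ip) ip' /\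
       dissipative ip' (delay_generator_domain DB)
         (fun u => delay_generator B zeta u - mu *: u))
  /\
  (lambda < - RS_integral_scalar (total_var zeta) (fun=> 1) (-1) 0 ->
     exists ip' : {dot (X * L2 X)%type for idfun},
       equivalent_ip (canonical_ip ip) ip' /\
       dissipative ip' (delay_generator_domain DB) (delay_generator B zeta)).
Proof.
split=> [m hm|hlambda].
  apply: (delay_generator_dissipative normE zeta_bounded zeta_BV _ B_dissipative hm).
  by rewrite ltW// (le_lt_trans _ hm)// lerDl sqrtr_ge0.
have V_nd := total_var_nondecreasing zeta_BV.
have exp0 : (fun r : R => expR (2 * 0 * r)) = (fun=> 1).
  by apply/funext => r; rewrite mulr0 mul0r expR0.
have V1 : RS_integral_scalar (total_var zeta) (fun=> 1) (-1) 0 =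
    total_var zeta 0 - total_var zeta (-1).
  rewrite -exp0 (RS_integral_exp V_nd); apply/eqP.
  (* At rate 0 the error bound vanishes, so the local estimate over the whole of [[-1, 0]] is an
     equality. *)
  have := exp_stieltjes_local V_nd (2 * 0) (lexx (-1)) (lexx _) (lerN10 _) (lexx 0).
  by rewrite mulr0 normr0 !mul0r mulr0 !mul0r expR0 mul1r normr_le0 subr_eq0.
have V0 : 0 <= total_var zeta 0 - total_var zeta (-1).
  by rewrite subr_ge0 V_nd// lerN10.
have [|ip' [ip'eq ip'diss]] :=
    @delay_generator_dissipative _ _ ip normE DB B zeta zeta_bounded zeta_BV
      lambda 0 0 (lexx 0) B_dissipative.
  by rewrite exp0 V1 -expr2 sqrtr_sqr ger0_norm// -ltrBrDr sub0r -V1.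
exists ip'; split => // u Du.
by have := ip'diss u Du; rewrite scale0r subr0.
Qed.
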